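(* Suppose that $\omega$-almost surely $|A|\le 1$, and let $$h_\star=\operatorname{argmin}_{h\in L^2(\mu)}\mathbb{E}_\omega|h(X)-A|^2,\qquad h_n(x)=\frac1n\sum_{j=1}^nA_j\,p_n(x,Y_j),\quad x\in\mathbb{R}^d .$$ Then $$\mathbb{E}\|h_\star-h_n\|_{L^2(\mu)}^2\lesssim\frac1n .$$
   Context: Fix $d\ge 1$, $n \ge 1$, $\eta>0$, and probability measures $\mu,\nu$ on $\mathbb{R}^d$ such that $\|x\|\le 1/2$ for $\mu$-almost every $x$ and $\|y\|\le 1/2$ for $\nu$-almost every $y$ (Euclidean norm). Let $\pi_\star$ be the Schrödinger coupling $$\pi_\star=\operatorname{argmin}_{\pi\in\Pi(\mu,\nu)}\Big\{\int\|x-y\|^2d\pi+\frac1\eta\mathsf{KL}(\pi\|\mu\otimes\nu)\Big\},$$ where $\Pi(\mu,\nu)$ is the set of couplings (it exists and is unique). Transfer learning model: $q(\cdot\mid y)$ is an unknown conditional distribution (Markov kernel) on $\mathbb{R}$. The joint distribution $\omega$ of $(X,Y,A)$ is given by $(X,Y)\sim\pi_\star$ and, conditionally on $(X,Y)$, $A\sim q(\cdot\mid Y)$. The observations are unlabeled $X_1,\dots,X_n\sim\mu$ i.i.d. and, independently of them, i.i.d. labeled pairs $(Y_1,A_1),\dots,(Y_n,A_n)$ with $Y_j\sim\nu$ and $A_j\sim q(\cdot\mid Y_j)$. Then $h_\star(x)=\mathbb{E}_\omega[A\mid X=x]$. Let $\mu_n=\frac1n\sum_{i=1}^n\delta_{X_i}$,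 $\nu_n=\frac1n\sum_{j=1}^n\delta_{Y_j}$. Empirical dual potentials: $(f_n,g_n)$ is the unique maximizer over $L^\infty(\mu_n)\times L^\infty(\nu_n)$ of $$\Phi_n(f,g)=\int f\,d\mu_n+\int g\,d\nu_n-\frac1\eta\int e^{-\eta(\|x-y\|^2-f(x)-g(y))}\,d(\mu_n\otimes\nu_n)+\frac1\eta$$ such that $\int g_n\,d\nu_n=0$. They are extended to all of $\mathbb{R}^d$ by $$e^{-\eta f_n(x)}=\frac1n\sum_{j=1}^n e^{-\eta\|x-Y_j\|^2+\eta g_n(Y_j)},\qquad e^{-\eta g_n(y)}=\frac1n\sum_{i=1}^n e^{-\eta\|X_i-y\|^2+\eta f_n(X_i)},$$ and $p_n(x,y)=e^{-\eta(\|x-y\|^2-f_n(x)-g_n(y))}$ for $x,y\in\mathbb{R}^d$. The notation $A\lesssim B$ means $A\le cB$ for a constant $c=c(\eta)$ depending only on $\eta$. *)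

(* Defs.v *)
From HB Require Import structures.
From mathcomp Require Import all_boot all_order all_algebra.
From mathcomp Require Import all_classical all_reals all_analysis.

Set Implicit Arguments.
Unset Strict Implicit.
Unset Printing Implicit Defensive.

Import Order.TTheory GRing.Theory Num.Theory.
Import numFieldNormedType.Exports.

Local Open Scope classical_set_scope.
Local Open Scope ring_scope.

Section euclidean_space.
Context (R : realType) (d : nat).

(* R^d is d.-tuple R: its library sigma-algebra, generated by the coordinates,
   is the Borel sigma-algebra of R^d. *)
Definition sqdist (x y : d.-tuple R) : R :=
  \sum_(i < d) (tnth x i - tnth y i) ^+ 2.

Definition enorm (x : d.-tuple R) : R := Num.sqrt (\sum_(i < d) tnth x i ^+ 2).

End euclidean_space.

Section entropic_transport.
Local Open Scope charge_scope.
Context (R : realType).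

(* When P `<< Q the density is finite everywhere and P-a.e. positive, and the
   negative part of its logarithm is P-integrable: the integral is a
   well-defined element of [0, +oo]. *)
Definition KL d (T : measurableType d) (P Q : probability T R) : \bar R :=
  if `[< P `<< Q >] then
    (\int[P]_z (ln (fine (('d (charge_of_finite_measure P) '/d Q) z)))%:E)%E
  else +oo%E.

Definition coupling d d' (T : measurableType d) (U : measurableType d')
    (mu : probability T R) (nu : probability U R)
    (p : probability (T * U)%type R) : Prop :=
  (forall A, measurable A -> p (A `*` setT) = mu A) /\
  (forall B, measurable B -> p (setT `*` B) = nu B).

Definition entropic_cost (eta : R) (d : nat)
    (mu nu : probability (d.-tuple R) R)
    (p : probability (d.-tuple R * d.-tuple R)%type R) : \bar R :=
  ((\int[p]_z (sqdist z.1 z.2)%:E) + (eta^-1)%:E * KL p (mu \x nu))%E.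

Definition schrodinger_coupling (eta : R) (d : nat)
    (mu nu : probability (d.-tuple R) R)
    (p : probability (d.-tuple R * d.-tuple R)%type R) : Prop :=
  coupling mu nu p /\
  forall p', coupling mu nu p' ->
    (entropic_cost eta mu nu p <= entropic_cost eta mu nu p')%E.

End entropic_transport.

Section transfer_model.
Context (R : realType).

(* w is the law of (Z, A) where Z ~ m and, conditionally on Z, A ~ k Z. *)
Definition joint_law d d' (T : measurableType d) (U : measurableType d')
    (m : {measure set T -> \bar R}) (k : T -> {measure set U -> \bar R})
    (w : {measure set (T * U) -> \bar R}) : Prop :=
  forall B C, measurable B -> measurable C ->
    w (B `*` C) = (\int[m]_(z in B) k z C)%E.

Definition mutually_independent d (Omega : measurableType d)
    (P : probability Omega R) (I : finType) (F : I -> set_system Omega) : Prop :=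
  forall (J : {set I}) (E : I -> set Omega),
    (forall i, i \in J -> F i (E i)) ->
    P (\bigcap_(i in [set` J]) E i) = (\prod_(i in J) P (E i))%E.

Definition sigma_of d d' (Omega : measurableType d) (T : measurableType d')
    (X : Omega -> T) : set_system Omega :=
  preimage_set_system setT X measurable.

(* The labeled pair (Y_j, A_j) is the single random variable L j. *)
Definition transfer_sample (d n : nat) (mu nu : probability (d.-tuple R) R)
    (q : R.-pker (d.-tuple R) ~> R)
    dO (Omega : measurableType dO) (P : probability Omega R)
    (X : 'I_n -> {RV P >-> d.-tuple R})
    (L : 'I_n -> {RV P >-> (d.-tuple R * R)%type}) : Prop :=
  [/\ mutually_independent P (fun k : 'I_n + 'I_n =>
        match k with inl i => sigma_of (X i) | inr j => sigma_of (L j) end),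
      forall i B, measurable B -> distribution P (X i) B = mu B &
      forall j, joint_law nu q (distribution P (L j))].

Definition sq_risk (d : nat)
    (omega : probability ((d.-tuple R * d.-tuple R) * R)%type R)
    (h : d.-tuple R -> R) : \bar R :=
  (\int[omega]_z (`|h z.1.1 - z.2| ^+ 2)%:E)%E.

Definition risk_minimizer (d : nat) (mu : probability (d.-tuple R) R)
    (omega : probability ((d.-tuple R * d.-tuple R) * R)%type R)
    (h : d.-tuple R -> R) : Prop :=
  h \in Lfun mu 2%:E /\
  forall h', h' \in Lfun mu 2%:E -> (sq_risk omega h <= sq_risk omega h')%E.

End transfer_model.

Section empirical_measure.
Local Open Scope ereal_scope.
Context d (T : measurableType d) (R : realType) (n : nat) (x : 'I_n -> T).

Definition empirical (A : set T) : \bar R :=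
  (n%:R^-1)%:E * \sum_(i < n) \d_(x i) A.

Let empirical0 : empirical set0 = 0.
Proof. by rewrite /empirical big1 ?mule0. Qed.

Let empirical_ge0 A : 0 <= empirical A.
Proof. by rewrite /empirical mule_ge0 ?sume_ge0// lee_fin invr_ge0. Qed.

Let empirical_sigma_additive : semi_sigma_additive empirical.
Proof.
move=> F mF tF mUF; rewrite /empirical.
under eq_fun.
  move=> k; rewrite -ge0_sume_distrr; last by move=> i _; exact: sume_ge0.
  rewrite exchange_big/=; over.
apply: cvgeZl => //; apply: cvg_nnesum => [i _|i _].
  by apply: nearW => k; exact: sume_ge0.
exact: measure_semi_sigma_additive.
Qed.

HB.instance Definition _ := isMeasure.Build _ _ _ empirical
  empirical0 empirical_ge0 empirical_sigma_additive.

Let empirical_fin : fin_num_fun empirical.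
Proof.
move=> A mA; rewrite /empirical fin_numM//; apply/sum_fin_numP => i _ _.
exact: fin_num_measure.
Qed.

HB.instance Definition _ := Measure_isFinite.Build _ _ _ empirical
  empirical_fin.

End empirical_measure.
Arguments empirical {d T} R {n} x.

Section empirical_potentials.
Context (R : realType) (eta : R) (d n : nat).
Implicit Types (x y : 'I_n -> d.-tuple R) (f g : d.-tuple R -> R).

Definition gibbs f g (u v : d.-tuple R) : R :=
  expR (- eta * (sqdist u v - f u - g v)).

Definition dual_functional x y f g : R :=
  (\int[empirical R x]_u f u) + (\int[empirical R y]_v g v)
  - eta^-1 * (\int[(empirical R x \x empirical R y)%E]_z gibbs f g z.1 z.2)
  + eta^-1.

Definition normalized_dual_maximizer x y f g : Prop :=
  [/\ f \in Lfun (empirical R x) +oo%E, g \in Lfun (empirical R y) +oo%E,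
      \int[empirical R y]_v g v = 0 &
      forall f' g',
        f' \in Lfun (empirical R x) +oo%E -> g' \in Lfun (empirical R y) +oo%E ->
        dual_functional x y f' g' <= dual_functional x y f g].

(* f0 and g0 matter only up to equality at the sample points. *)
Definition empirical_potentials x y f g : Prop :=
  exists f0 g0, [/\ normalized_dual_maximizer x y f0 g0,
    forall u, expR (- eta * f u) =
      n%:R^-1 * \sum_(j < n) expR (- eta * sqdist u (y j) + eta * g0 (y j)) &
    forall v, expR (- eta * g v) =
      n%:R^-1 * \sum_(i < n) expR (- eta * sqdist (x i) v + eta * f0 (x i))].

Definition transfer_estimator (y : 'I_n -> d.-tuple R) (a : 'I_n -> R) f g
    (u : d.-tuple R) : R :=
  n%:R^-1 * \sum_(j < n) a j * gibbs f g u (y j).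

End empirical_potentials.

(* Main.v *)
Require Import Defs.
From HB Require Import structures.
From mathcomp Require Import all_boot all_order all_algebra.
From mathcomp Require Import all_classical all_reals all_analysis.
From mathcomp Require Import measurable_realfun ess_sup_inf ring lra.

Set Implicit Arguments.
Unset Strict Implicit.
Unset Printing Implicit Defensive.

Import Order.TTheory GRing.Theory Num.Theory.
Import numFieldNormedType.Exports.

Local Open Scope classical_set_scope.
Local Open Scope ring_scope.

(** The proof compares the estimator with its population analogue, in which the
    empirical density p_n is replaced by the Schrodinger density.

    Population side.  The kernel K = exp(- eta |x - y|^2) takes values in
    [e, 1] on the supports, with e = exp(- eta).  A Sinkhorn iteration
    therefore contracts ratios by the factor 1 - e (the Doeblin bound), which
    yields bounded scalings a, b such that p = K a b has both conditional
    masses equal to 1 ([schrodinger_system]).  Since ln p is, up to the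
    transport cost, a sum of functions of one variable, optimality and the
    Gibbs inequality force the Schrodinger coupling to be p (mu x nu)
    ([gibbs_variational], [schrodinger_coupling_density]).  Consequently (X, Y, A)
    has law p(x, y) mu(dx) m(dy, da), where m is the law of a labelled
    observation, and the risk minimizer is h0(x) = \int a p(x, y) m(dy, da)
    ([risk_minimizer_regression]).

    Empirical side.  Maximality of the dual functional implies that p_n has
    unit marginals on the sample ([empirical_potentials_marginals]).  On the
    sample, p_n and p differ by log-scalings u_i + v_j.  Multiplying the
    difference by u_i + v_j and summing gives the strong concavity estimate
    avg u^2 + avg v^2 <= C (marginal defects of p)^2 ([scaling_stability]),
    where the defects are 1 - avg_j p(x, Y_j) and 1 - avg_i p(X_i, y).  The
    formula extending the potentials off the sample transfers this to every x
    in the ball ([row_stability], [estimator_stability]).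

    Conclusion.  The squared error at x is thus bounded by the square of
    avg_j A_j p(x, Y_j) - h0(x) plus squared defects.  Each of these is an
    average of n bounded terms that are centred and independent, conditionally
    on the remaining point, so its second moment is O(1/n)
    ([variance_average]).  No measurability of the potentials in the sample is
    needed, because the outer integral is dominated by that of a measurable
    function ([ge0_ae_le_integral_lower]). *)

(** * Calculus of bounded measurable functions *)

(** Bounded measurable real functions: the class of integrands used throughout;
    they are integrable for every finite measure. *)
Definition bmeas d (T : measurableType d) (R : realType) (f : T -> R) : Prop :=
  measurable_fun setT f /\ exists M, forall x, `|f x| <= M.

Section bounded_measurable.
Context d (T : measurableType d) (R : realType).
Implicit Types f g : T -> R.

Lemma bmeas_cst (c : R) : bmeas (fun _ : T => c).
Proof. by split; [exact: measurable_cst|exists `|c|]. Qed.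

Lemma bmeasD f g : bmeas f -> bmeas g -> bmeas (fun x => f x + g x).
Proof.
move=> [mf [M fM]] [mg [N gN]]; split; first exact: measurable_funD.
by exists (M + N) => x; rewrite (le_trans (ler_normD _ _))// lerD.
Qed.

Lemma bmeasN f : bmeas f -> bmeas (fun x => - f x).
Proof.
move=> [mf [M fM]]; split; first exact: measurableT_comp.
by exists M => x; rewrite normrN.
Qed.

Lemma bmeasB f g : bmeas f -> bmeas g -> bmeas (fun x => f x - g x).
Proof. by move=> bf bg; apply: bmeasD => //; exact: bmeasN. Qed.

Lemma bmeasM f g : bmeas f -> bmeas g -> bmeas (fun x => f x * g x).
Proof.
move=> [mf [M fM]] [mg [N gN]]; split; first exact: measurable_funM.
by exists (M * N) => x; rewrite normrM ler_pM.
Qed.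

Lemma bmeasX f n : bmeas f -> bmeas (fun x => f x ^+ n).
Proof.
move=> bf; elim: n => [|n IH].
  by rewrite (_ : (fun _ => _) = fun=> 1)//; exact: bmeas_cst.
rewrite (_ : (fun _ => _) = fun x => f x * f x ^+ n); first exact: bmeasM.
by apply/funext => x; rewrite exprS.
Qed.

Lemma bmeas_sum (I : Type) (s : seq I) (F : I -> T -> R) :
  (forall i, bmeas (F i)) -> bmeas (fun x => \sum_(i <- s) F i x).
Proof.
move=> bF; elim: s => [|i s IH].
  rewrite (_ : (fun _ => _) = fun=> 0); first exact: bmeas_cst.
  by apply/funext => x; rewrite big_nil.
rewrite (_ : (fun _ => _) = fun x => F i x + \sum_(j <- s) F j x).
  exact: bmeasD.
by apply/funext => x; rewrite big_cons.
Qed.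

Lemma bmeas_inv f (e : R) : 0 < e -> (forall x, e <= f x) -> bmeas f ->
  bmeas (fun x => (f x)^-1).
Proof.
move=> e0 ef [mf _]; split.
  rewrite (_ : (fun _ => _) = fun x => expR (- ln (f x))).
    by do 2 apply: measurableT_comp => //; exact: measurableT_comp.
  apply/funext => x; rewrite expRN lnK// posrE.
  exact: lt_le_trans (ef x).
by exists e^-1 => x; rewrite normfV lef_pV2 ?posrE ?gtr0_norm// ?(lt_le_trans e0).
Qed.

Lemma bmeas_comp d' (U : measurableType d') (h : U -> R) (phi : T -> U) :
  measurable_fun setT phi -> bmeas h -> bmeas (fun x => h (phi x)).
Proof.
move=> mphi [mh [M hM]]; split; first exact: measurableT_comp.
by exists M => x.
Qed.

Lemma bmeas_expR f : bmeas f -> bmeas (fun x => expR (f x)).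
Proof.
move=> [mf [M fM]]; split; first exact: measurableT_comp.
exists (expR M) => x; rewrite ger0_norm ?expR_ge0// ler_expR.
exact: le_trans (ler_norm _) (fM x).
Qed.

Lemma bmeas_ln f (e : R) : 0 < e -> (forall x, e <= f x) -> bmeas f ->
  bmeas (fun x => ln (f x)).
Proof.
move=> e0 ef [mf [M fM]]; split; first exact: measurableT_comp.
exists (M + e^-1) => x.
have fx0 : 0 < f x by exact: lt_le_trans (ef x).
have fxM : f x <= M by exact: le_trans (ler_norm _) (fM x).
have i0 : 0 < (f x)^-1 by rewrite invr_gt0.
have ie : (f x)^-1 <= e^-1 by rewrite lef_pV2 ?posrE.
have h1 := ln_sublinear fx0; have h2 := ln_sublinear i0.
rewrite lnV ?posrE// in h2.
by rewrite ler_norml; apply/andP; split; lra.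
Qed.

End bounded_measurable.

Section bounded_integral.
Context d (T : measurableType d) (R : realType).
Variable mu : {finite_measure set T -> \bar R}.
Implicit Types f g : T -> R.

Lemma bmeas_integrable f : bmeas f -> mu.-integrable setT (EFin \o f).
Proof.
move=> [mf [M fM]]; apply: measurable_bounded_integrable => //.
  by rewrite -ge0_fin_numE// fin_num_measure.
exists M; split; first exact: num_real.
by move=> x Mx t _; exact: le_trans (fM t) (ltW Mx).
Qed.

Lemma bmeas_RintegralE f : bmeas f ->
  (\int[mu]_x (f x)%:E)%E = (\int[mu]_x f x)%:E.
Proof.
by move=> /bmeas_integrable bf; rewrite fineK//; exact: integrable_fin_num.
Qed.

Lemma bmeas_RintegralD f g : bmeas f -> bmeas g ->
  \int[mu]_x (f x + g x) = \int[mu]_x f x + \int[mu]_x g x.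
Proof. by move=> bf bg; rewrite RintegralD//; exact: bmeas_integrable. Qed.

Lemma bmeas_RintegralB f g : bmeas f -> bmeas g ->
  \int[mu]_x (f x - g x) = \int[mu]_x f x - \int[mu]_x g x.
Proof. by move=> bf bg; rewrite RintegralB//; exact: bmeas_integrable. Qed.

Lemma bmeas_RintegralZl (k : R) f : bmeas f ->
  \int[mu]_x (k * f x) = k * \int[mu]_x f x.
Proof. by move=> bf; rewrite RintegralZl//; exact: bmeas_integrable. Qed.

Lemma bmeas_RintegralZr (k : R) f : bmeas f ->
  \int[mu]_x (f x * k) = (\int[mu]_x f x) * k.
Proof. by move=> bf; rewrite RintegralZr//; exact: bmeas_integrable. Qed.

Lemma bmeas_Rintegral_sum (I : Type) (s : seq I) (F : I -> T -> R) :
  (forall i, bmeas (F i)) ->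
  \int[mu]_x (\sum_(i <- s) F i x) = \sum_(i <- s) \int[mu]_x F i x.
Proof.
move=> bF; elim: s => [|i s IH].
  rewrite big_nil -[RHS](mul0r (fine (mu setT))) -Rintegral_cst//.
  by apply: eq_Rintegral => x _; rewrite big_nil.
rewrite big_cons -IH -bmeas_RintegralD//; last exact: bmeas_sum.
by apply: eq_Rintegral => x _; rewrite big_cons.
Qed.

Lemma bmeas_le_Rintegral f g : bmeas f -> bmeas g -> (forall x, f x <= g x) ->
  \int[mu]_x f x <= \int[mu]_x g x.
Proof.
by move=> bf bg fg; apply: le_Rintegral => //; exact: bmeas_integrable.
Qed.

End bounded_integral.

Section bounded_integral_probability.
Context d (T : measurableType d) (R : realType) (P : probability T R).
Implicit Types f g : T -> R.

Lemma Rintegral_probability_cst (c : R) : \int[P]_x c = c.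
Proof.
have PT : fine (P setT) = 1 by rewrite probability_setT.
by rewrite -[RHS]mulr1 -PT; exact: Rintegral_cst.
Qed.

Lemma le_Rintegral_cst f (M : R) : bmeas f -> (forall x, f x <= M) ->
  \int[P]_x f x <= M.
Proof.
move=> bf fM; rewrite -[leRHS]Rintegral_probability_cst.
by apply: bmeas_le_Rintegral => //; exact: bmeas_cst.
Qed.

Lemma ge_Rintegral_cst f (M : R) : bmeas f -> (forall x, M <= f x) ->
  M <= \int[P]_x f x.
Proof.
move=> bf fM; rewrite -[leLHS]Rintegral_probability_cst.
by apply: bmeas_le_Rintegral => //; exact: bmeas_cst.
Qed.

Lemma normr_Rintegral_le f (M : R) : bmeas f -> (forall x, `|f x| <= M) ->
  `|\int[P]_x f x| <= M.
Proof.
move=> bf fM; rewrite ler_norml; apply/andP; split.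
  by apply: ge_Rintegral_cst => // x; have := fM x; rewrite ler_norml => /andP[].
by apply: le_Rintegral_cst => // x; exact: le_trans (ler_norm _) (fM x).
Qed.

End bounded_integral_probability.

Section bounded_pushforward.
Context d d' (T : measurableType d) (U : measurableType d') (R : realType).

Lemma bmeas_Rintegral_pushforward (mu : {finite_measure set T -> \bar R})
    (nu : {finite_measure set U -> \bar R}) (phi : T -> U) (f : U -> R) :
  measurable_fun setT phi -> (forall B, measurable B -> nu B = mu (phi @^-1` B)) ->
  bmeas f -> \int[nu]_y f y = \int[mu]_x f (phi x).
Proof.
move=> mphi nuE bf; congr fine.
rewrite (eq_measure_integral (pushforward mu phi)); last first.
  by move=> A mA _; exact: nuE.
have bfphi := bmeas_comp mphi bf.
rewrite integral_pushforward//.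
  by case: bf => mf _; exact/measurable_EFinP.
exact: (bmeas_integrable mu bfphi).
Qed.

End bounded_pushforward.

(** Fubini's theorem for bounded integrands, with real-valued iterated integrals. *)
Section bounded_fubini.
Context d1 d2 (T1 : measurableType d1) (T2 : measurableType d2) (R : realType).
Variables (m1 : probability T1 R) (m2 : probability T2 R).
Variables (f : T1 * T2 -> R) (bf : bmeas f).

Lemma bmeas_section1 x : bmeas (fun y => f (x, y)).
Proof. exact: (bmeas_comp (pair1_measurable x) bf). Qed.

Lemma bmeas_section2 y : bmeas (fun x => f (x, y)).
Proof. exact: (bmeas_comp (pair2_measurable y) bf). Qed.

Let prod_integrable : (m1 \x m2)%E.-integrable setT (EFin \o f).
Proof. exact: (bmeas_integrable ((m1 \x m2)%E : probability _ R) bf). Qed.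

Lemma bmeas_Rintegral1 : bmeas (fun x => \int[m2]_y f (x, y)).
Proof.
case: (bf) => mf [M fM]; split.
  apply/measurable_EFinP.
  rewrite (_ : _ \o _ = fubini_F m2 (EFin \o f)); first exact: (measurable_fubini_F prod_integrable).
  apply/funext => x; rewrite /fubini_F/=.
  by rewrite (bmeas_RintegralE m2 (bmeas_section1 x)).
by exists M => x; apply: normr_Rintegral_le => //; exact: bmeas_section1.
Qed.

Lemma bmeas_Rintegral2 : bmeas (fun y => \int[m1]_x f (x, y)).
Proof.
case: (bf) => mf [M fM]; split.
  apply/measurable_EFinP.
  rewrite (_ : _ \o _ = fubini_G m1 (EFin \o f)); first exact: (measurable_fubini_G prod_integrable).
  apply/funext => x; rewrite /fubini_G/=.
  by rewrite (bmeas_RintegralE m1 (bmeas_section2 x)).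
by exists M => x; apply: normr_Rintegral_le => //; exact: bmeas_section2.
Qed.

Lemma bmeas_Rintegral_prod12 :
  \int[(m1 \x m2)%E]_z f z = \int[m1]_x \int[m2]_y f (x, y).
Proof.
rewrite [LHS]/Rintegral -(integral12_prod_meas1 prod_integrable)/= [RHS]/Rintegral.
congr fine; apply: eq_integral => x _.
by rewrite /fubini_F/= (bmeas_RintegralE m2 (bmeas_section1 x)).
Qed.

Lemma bmeas_Rintegral_prod21 :
  \int[(m1 \x m2)%E]_z f z = \int[m2]_y \int[m1]_x f (x, y).
Proof.
rewrite [LHS]/Rintegral -(integral21_prod_meas1 prod_integrable)/= [RHS]/Rintegral.
congr fine; apply: eq_integral => x _.
by rewrite /fubini_G/= (bmeas_RintegralE m1 (bmeas_section2 x)).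
Qed.

End bounded_fubini.

(** * Measures on products, densities *)

Section box_uniqueness.
Context d1 d2 (T1 : measurableType d1) (T2 : measurableType d2) (R : realType).

(** Rectangles form a pi-system generating the product sigma-algebra. *)
Lemma measure_eq_on_boxes (m m' : {measure set (T1 * T2) -> \bar R}) :
  (m setT < +oo)%E ->
  (forall A B, measurable A -> measurable B -> m (A `*` B) = m' (A `*` B)) ->
  forall E, measurable E -> m E = m' E.
Proof.
move=> moo mm' E mE.
pose G : set (set (T1 * T2)) :=
  [set C | exists A, measurable A /\ exists B, measurable B /\ C = A `*` B].
apply: (measure_unique G (fun=> setT)) => //.
- rewrite measurable_prod_measurableType //; congr (<<s _ >>).
  rewrite predeqE; split => [[A mA [B mB <-]]|[A [mA [B [mB ->]]]]].
    by exists A; split => //; exists B.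
  by exists A => //; exists B.
- move=> /= _ _ [X1 [mX1 [X2 [mX2 ->]]]] [Y1 [mY1 [Y2 [mY2 ->]]]].
  rewrite -setXI; exists (X1 `&` Y1); split; first exact: measurableI.
  by exists (X2 `&` Y2); split => //; exact: measurableI.
- by move=> n; exists setT; split => //; exists setT; split => //; rewrite setXTT.
- by rewrite bigcup_const//; exists 0%N.
- by move=> A [A1 [mA1 [A2 [mA2 ->]]]]; rewrite mm'.
Qed.

End box_uniqueness.

(** Consequences of having a bounded density [p]: [nu A = \int_A p dmu]. *)
Section has_density.
Context d (T : measurableType d) (R : realType).
Variables (nu mu : {finite_measure set T -> \bar R}) (p : T -> R).
Hypothesis bp : bmeas p.
Hypothesis nuE : forall A, measurable A -> nu A = (\int[mu]_(x in A) (p x)%:E)%E.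

Lemma has_density_dominates : nu `<< mu.
Proof.
apply/null_content_dominatesP => A mA A0; rewrite nuE//; apply: null_set_integral => //.
by case: bp => mp _; apply/measurable_EFinP; exact: measurable_funTS.
Qed.

Local Open Scope charge_scope.

Lemma has_density_Radon_Nikodym :
  ae_eq mu setT (EFin \o p) ('d (charge_of_finite_measure nu) '/d mu).
Proof.
apply: integral_ae_eq => //.
- exact: bmeas_integrable.
- by apply: measurable_int; apply: Radon_Nikodym_integrable; exact: has_density_dominates.
- move=> A _ mA; rewrite -Radon_Nikodym_integral//=; last exact: has_density_dominates.
  exact: (esym (nuE mA)).
Qed.

Lemma has_density_integral (f : T -> \bar R) : nu.-integrable setT f ->
  (\int[nu]_x f x = \int[mu]_x (f x * (p x)%:E))%E.
Proof.
move=> intf; rewrite -(Radon_Nikodym_change_of_variables has_density_dominates)//.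
have mf := measurable_int _ intf.
apply: ae_eq_integral => //.
- apply: emeasurable_funM => //.
  by apply: measurable_int; apply: Radon_Nikodym_integrable; exact: has_density_dominates.
- by apply: emeasurable_funM => //; apply/measurable_EFinP; case: bp.
- by apply: ae_eqe_mul2l; apply: ae_eq_sym; exact: has_density_Radon_Nikodym.
Qed.

Lemma has_density_Rintegral (f : T -> R) : bmeas f ->
  \int[nu]_x f x = \int[mu]_x (f x * p x).
Proof.
move=> bf; congr fine.
by rewrite has_density_integral//; exact: bmeas_integrable.
Qed.

End has_density.

(** The measure with bounded density [p] with respect to [mu]. *)
Definition density d (T : measurableType d) (R : realType)
    (mu : {finite_measure set T -> \bar R}) (p : T -> R)
    (bp : bmeas p) (p0 : forall x, 0 <= p x) (A : set T) : \bar R :=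
  (\int[mu]_(x in A) (p x)%:E)%E.

Section density.
Context d (T : measurableType d) (R : realType).
Variables (mu : {finite_measure set T -> \bar R}) (p : T -> R).
Variables (bp : bmeas p) (p0 : forall x, 0 <= p x).
Local Notation nu := (density mu bp p0).

Let density0 : nu set0 = 0%E.
Proof. by rewrite /density integral_set0. Qed.

Let density_ge0 A : (0 <= nu A)%E.
Proof. by apply: integral_ge0 => x _; rewrite lee_fin. Qed.

Let density_sigma_additive : semi_sigma_additive nu.
Proof.
move=> F mF tF mUF; rewrite /density ge0_integral_bigcup//.
- apply: is_cvg_ereal_nneg_natsum_cond => n _ _.
  by apply: integral_ge0 => x _; rewrite lee_fin.
- by case: bp => mp _; apply/measurable_EFinP; exact: measurable_funTS.
- by move=> x _; rewrite lee_fin.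
Qed.

HB.instance Definition _ := isMeasure.Build _ _ _ nu
  density0 density_ge0 density_sigma_additive.

Let density_fin : fin_num_fun nu.
Proof.
move=> A mA; apply: integrable_fin_num => //.
by apply: (integrableS measurableT) => //; exact: bmeas_integrable.
Qed.

HB.instance Definition _ := Measure_isFinite.Build _ _ _ nu density_fin.

End density.

Lemma bmeas_indic d (T : measurableType d) (R : realType) (A : set T) :
  measurable A -> bmeas (\1_A : T -> R).
Proof.
move=> mA; split; first exact: measurable_indic.
by exists 1 => x; rewrite indicE; case: (_ \in _); rewrite ?normr1 ?normr0.
Qed.

Lemma measure_Rintegral d (T : measurableType d) (R : realType)
    (m : {finite_measure set T -> \bar R}) (A : set T) :
  measurable A -> m A = (\int[m]_x (\1_A x))%:E.
Proof.
move=> mA; rewrite -bmeas_RintegralE; last exact: bmeas_indic.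
by rewrite integral_indic// setIT.
Qed.

Lemma density_Rintegral d (T : measurableType d) (R : realType)
    (mu : {finite_measure set T -> \bar R}) (p : T -> R) (A : set T) :
  bmeas p -> measurable A ->
  (\int[mu]_(x in A) (p x)%:E)%E = (\int[mu]_x (\1_A x * p x))%:E.
Proof.
move=> bp mA; rewrite -bmeas_RintegralE; last by apply: bmeasM => //; exact: bmeas_indic.
rewrite integral_mkcond; apply: eq_integral => x _.
rewrite patchE indicE; case: ifPn => _; first by rewrite mul1r.
by rewrite mul0r.
Qed.

(** * Existence of Schrodinger potentials *)

Lemma geometric_le0 (R : realType) (C q x : R) : 0 <= q -> q < 1 ->
  (forall k, x <= C * q ^+ k) -> x <= 0.
Proof.
move=> q0 q1 xC.
have q1' : `|q| < 1 by rewrite ger0_norm.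
have /cvgrPdist_lt h := cvg_geometric C q1'.
apply/ler_addgt0Pr => eps eps0; rewrite add0r.
have [k _ kh] := h _ eps0.
have /= := kh k (leqnn _); rewrite sub0r normrN => /ltW hk.
exact: le_trans (xC k) (le_trans (ler_norm _) hk).
Qed.

(** A sequence with geometrically small increments has a limit, with the
    explicit rate of the nested intervals [u_k - C q^k/(1-q), u_k + C q^k/(1-q)]. *)
Lemma geometric_limit (R : realType) (C q : R) (u : nat -> R) :
  0 <= C -> 0 <= q -> q < 1 -> (forall k, `|u k.+1 - u k| <= C * q ^+ k) ->
  exists l, forall k, `|l - u k| <= C / (1 - q) * q ^+ k.
Proof.
move=> C0 q0 q1 uq.
have q1' : 0 < 1 - q by rewrite subr_gt0.
pose r k := C / (1 - q) * q ^+ k.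
have rS k : r k = C * q ^+ k + r k.+1.
  by rewrite /r exprS; field; rewrite gt_eqF.
have r0 k : 0 <= r k by rewrite mulr_ge0 ?divr_ge0 ?exprn_ge0// ltW.
have low j k : u j - r j <= u (j + k)%N - r (j + k)%N.
  elim: k => [|k IH]; first by rewrite addn0.
  apply: (le_trans IH); rewrite addnS.
  by have := uq (j + k)%N; rewrite ler_norml (rS (j + k)%N) => /andP[? _]; lra.
have upp j k : u (j + k)%N + r (j + k)%N <= u j + r j.
  elim: k => [|k IH]; first by rewrite addn0.
  apply: le_trans IH; rewrite addnS.
  by have := uq (j + k)%N; rewrite ler_norml (rS (j + k)%N) => /andP[_ ?]; lra.
have cross j k : u j - r j <= u k + r k.
  have := low j k; have := upp k j; rewrite addnC.
  by have := r0 (j + k)%N; lra.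
pose E := range (fun k => u k - r k).
have Eub k : ubound E (u k + r k) by move=> _ [j _ <-].
have supE : has_sup E by split; [exists (u 0%N - r 0%N); exists 0%N|exists (u 0%N + r 0%N)].
exists (sup E) => k; rewrite ler_norml; apply/andP; split.
  have : u k - r k <= sup E by apply: sup_upper_bound => //; exists k.
  by rewrite /r; lra.
have : sup E <= u k + r k by apply: ge_sup; [case: supE|exact: Eub].
by rewrite /r; lra.
Qed.

Section sinkhorn.
Context d1 d2 (T : measurableType d1) (U : measurableType d2) (R : realType).
Variables (mu : probability T R) (nu : probability U R).
Variables (K : T * U -> R) (bK : bmeas K) (e : R) (e0 : 0 < e).
Hypothesis eK : forall z, e <= K z.
Hypothesis K1 : forall z, K z <= 1.

Let e1 : e <= 1.
Proof.
have [x _] : exists x : T, True by exact: (ex_intro _ point).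
have [y _] : exists y : U, True by exact: (ex_intro _ point).
exact: le_trans (eK (x, y)) (K1 _).
Qed.

(* The two kernel operators, on scalings of [U] and of [T]. *)
Let I1 (b : U -> R) x := \int[nu]_y (K (x, y) * b y).
Let I2 (a : T -> R) y := \int[mu]_x (K (x, y) * a x).

Let bK1 x : bmeas (fun y => K (x, y)). Proof. exact: bmeas_section1. Qed.
Let bK2 y : bmeas (fun x => K (x, y)). Proof. exact: bmeas_section2. Qed.

Let bKb b : bmeas b -> bmeas (fun z : T * U => K z * b z.2).
Proof. by move=> bb; apply: bmeasM => //; exact: (bmeas_comp measurable_snd). Qed.

Let bKa a : bmeas a -> bmeas (fun z : T * U => K z * a z.1).
Proof. by move=> ba; apply: bmeasM => //; exact: (bmeas_comp measurable_fst). Qed.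

Let bI1 b : bmeas b -> bmeas (I1 b).
Proof. by move=> bb; exact: (bmeas_Rintegral1 mu nu (bKb bb)). Qed.

Let bI2 a : bmeas a -> bmeas (I2 a).
Proof. by move=> ba; exact: (bmeas_Rintegral2 mu nu (bKa ba)). Qed.

(* Scalings of [U] normalized to mean one: the domain of the iteration. *)
Let mean1 (b : U -> R) := [/\ bmeas b, forall y, e <= b y <= e^-1 & \int[nu]_y b y = 1].

Let I1_bnd b : mean1 b -> forall x, e <= I1 b x <= 1.
Proof.
move=> [bb be b1] x; have b0 y : 0 <= b y.
  by have /andP[+ _] := be y; apply: le_trans; exact: ltW.
apply/andP; split.
  rewrite -[leLHS]mulr1 -b1 -bmeas_RintegralZl//; apply: bmeas_le_Rintegral => //.
  - by apply: bmeasM => //; exact: bmeas_cst.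
  - exact: bmeasM.
  - by move=> y; rewrite ler_wpM2r.
rewrite -[leRHS]b1; apply: bmeas_le_Rintegral => //; first exact: bmeasM.
by move=> y; rewrite ler_piMl.
Qed.

(* The scaling of [T] that makes every row of [K a b] integrate to one. *)
Let S1 b x := (I1 b x)^-1.

Let bS1 b : mean1 b -> bmeas (S1 b).
Proof.
move=> mb; apply: (bmeas_inv e0); last by apply: bI1; case: mb.
by move=> x; have /andP[] := I1_bnd mb x.
Qed.

Let S1_bnd b : mean1 b -> forall x, 1 <= S1 b x <= e^-1.
Proof.
move=> mb x; have /andP[l1 l2] := I1_bnd mb x.
have I0 : 0 < I1 b x by exact: lt_le_trans l1.
by rewrite /S1 invf_ge1// l2 lef_pV2.
Qed.

Let A b := \int[mu]_x S1 b x.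

Let A_gt0 b : mean1 b -> 0 < A b.
Proof.
move=> mb; apply: (lt_le_trans ltr01); apply: ge_Rintegral_cst.
  exact: bS1.
by move=> x; have /andP[] := S1_bnd mb x.
Qed.

Let I2_bnd b : mean1 b -> forall y, e * A b <= I2 (S1 b) y <= A b.
Proof.
move=> mb y; have S0 x : 0 <= S1 b x.
  by have /andP[+ _] := S1_bnd mb x; apply: le_trans; exact: ler01.
have bS := bS1 mb.
apply/andP; split.
  rewrite -bmeas_RintegralZl//; apply: bmeas_le_Rintegral => //.
  - by apply: bmeasM => //; exact: bmeas_cst.
  - exact: bmeasM.
  - by move=> x; rewrite ler_wpM2r.
by apply: bmeas_le_Rintegral => //; [exact: bmeasM|move=> x; rewrite ler_piMl].
Qed.

(* The scaling of [U] that makes every column of [K a b] integrate to one,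
   for [a = S1 b]. *)
Let F b y := (I2 (S1 b) y)^-1.

Let I2_gt0 b : mean1 b -> forall y, 0 < I2 (S1 b) y.
Proof.
move=> mb y; have /andP[+ _] := I2_bnd mb y; apply: lt_le_trans.
by rewrite mulr_gt0// A_gt0.
Qed.

Let bF b : mean1 b -> bmeas (F b).
Proof.
move=> mb; apply: (@bmeas_inv _ _ _ _ (e * A b)).
- by rewrite mulr_gt0// A_gt0.
- by move=> y; have /andP[] := I2_bnd mb y.
- by apply: bI2; exact: bS1.
Qed.

Let F_bnd b : mean1 b -> forall y, (A b)^-1 <= F b y <= e^-1 * (A b)^-1.
Proof.
move=> mb y; have /andP[l1 l2] := I2_bnd mb y; have A0 := A_gt0 mb.
have I0 := I2_gt0 mb y.
by rewrite /F -invfM !lef_pV2 ?posrE ?mulr_gt0// l2.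
Qed.

Let lam b := \int[nu]_y F b y.

Let lam_bnd b : mean1 b -> (A b)^-1 <= lam b <= e^-1 * (A b)^-1.
Proof.
move=> mb; apply/andP; split.
  by apply: ge_Rintegral_cst; [exact: bF|move=> y; case/andP: (F_bnd mb y)].
by apply: le_Rintegral_cst; [exact: bF|move=> y; case/andP: (F_bnd mb y)].
Qed.

Let lam_gt0 b : mean1 b -> 0 < lam b.
Proof.
move=> mb; have /andP[+ _] := lam_bnd mb; apply: lt_le_trans.
by rewrite invr_gt0 A_gt0.
Qed.

(* One normalized Sinkhorn iteration. *)
Let N b y := F b y / lam b.

Let mean1N b : mean1 b -> mean1 (N b).
Proof.
move=> mb; have l0 := lam_gt0 mb; have A0 := A_gt0 mb.
have /andP[l1 l2] := lam_bnd mb; have bFb := bF mb.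
have ei0 : 0 < e^-1 by rewrite invr_gt0.
split.
- by apply: bmeasM => //; exact: bmeas_cst.
- move=> y; have /andP[f1 f2] := F_bnd mb y.
  rewrite /N ler_pdivlMr// ler_pdivrMr//; apply/andP; split.
    apply: le_trans f1.
    by rewrite mulrC -ler_pdivlMr// mulrC.
  by apply: (le_trans f2); rewrite ler_wpM2l// ltW.
- by rewrite /N bmeas_RintegralZr// divff// gt_eqF.
Qed.

(** The Doeblin bound [K >= e] makes one Sinkhorn iteration contract the
    oscillation of ratios by the factor [1 - e]. *)
Let contraction b b' (m M : R) : mean1 b -> mean1 b' -> 0 < m ->
  (forall y, m * b y <= b' y <= M * b y) ->
  exists m' M', [/\ 0 < m', forall y, m' * N b y <= N b' y <= M' * N b y &
    M' / m' - 1 <= (1 - e) * (M / m - 1)].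
Proof.
move=> mb mb' m0 mM; have [bb be b1] := mb; have [bb' be' b1'] := mb'.
have Rbb' k : \int[nu]_y (k * b y) = k by rewrite bmeas_RintegralZl// b1 mulr1.
have bkb k : bmeas (fun y => k * b y) by apply: bmeasM => //; exact: bmeas_cst.
have m1 : m <= 1.
  rewrite -(Rbb' m) -b1'; apply: bmeas_le_Rintegral => // y.
  by case/andP: (mM y).
have M1 : 1 <= M.
  rewrite -(Rbb' M) -b1'; apply: bmeas_le_Rintegral => // y.
  by case/andP: (mM y).
have e1' := e1.
pose m1' := (1 - e) * m + e; pose M1' := (1 - e) * M + e.
have m1'm : m <= m1'.
  have : 0 <= e * (1 - m) by rewrite mulr_ge0 ?subr_ge0// ltW.
  by rewrite /m1'; lra.
have m1'0 : 0 < m1' by exact: lt_le_trans m1'm.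
have M1'0 : 0 < M1' by rewrite /M1' ltr_wpDl// mulr_ge0 ?subr_ge0// (le_trans ler01).
(* As [K >= e] and [I1 b <= 1], the nonnegative functions [b' - m b] and
   [M b - b'], of masses [1 - m] and [M - 1], contribute at least
   [e (1 - m) I1 b] and [e (M - 1) I1 b] at every point. *)
have gain1 x : m1' * I1 b x <= I1 b' x.
  have /andP[i0 i1] := I1_bnd mb x.
  have : e * (1 - m) <= I1 b' x - m * I1 b x.
    rewrite /I1 -bmeas_RintegralZl; last exact: bmeasM.
    rewrite -bmeas_RintegralB; [|exact: bmeasM|]; last first.
      by apply: bmeasM; [exact: bmeas_cst|exact: bmeasM].
    have -> : 1 - m = \int[nu]_y (b' y - m * b y).
      by rewrite bmeas_RintegralB// b1' Rbb'.
    rewrite -bmeas_RintegralZl; last exact: bmeasB.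
    apply: bmeas_le_Rintegral.
    - by apply: bmeasM; [exact: bmeas_cst|exact: bmeasB].
    - by apply: bmeasB; [exact: bmeasM|apply: bmeasM; [exact: bmeas_cst|exact: bmeasM]].
    - move=> y; rewrite (mulrCA m) -mulrBr; apply: ler_wpM2r => //.
      by rewrite subr_ge0; case/andP: (mM y).
  have : 0 <= e * (1 - m) * (1 - I1 b x) by rewrite !mulr_ge0 ?subr_ge0// ltW.
  by rewrite /m1'; lra.
have gain2 x : I1 b' x <= M1' * I1 b x.
  have /andP[i0 i1] := I1_bnd mb x.
  have : e * (M - 1) <= M * I1 b x - I1 b' x.
    rewrite /I1 -bmeas_RintegralZl; last exact: bmeasM.
    rewrite -bmeas_RintegralB; [| |exact: bmeasM]; last first.
      by apply: bmeasM; [exact: bmeas_cst|exact: bmeasM].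
    have -> : M - 1 = \int[nu]_y (M * b y - b' y).
      by rewrite bmeas_RintegralB// b1' Rbb'.
    rewrite -bmeas_RintegralZl; last exact: bmeasB.
    apply: bmeas_le_Rintegral.
    - by apply: bmeasM; [exact: bmeas_cst|exact: bmeasB].
    - by apply: bmeasB; [apply: bmeasM; [exact: bmeas_cst|exact: bmeasM]|exact: bmeasM].
    - move=> y; rewrite (mulrCA M) -mulrBr; apply: ler_wpM2r => //.
      by rewrite subr_ge0; case/andP: (mM y).
  have : 0 <= e * (M - 1) * (1 - I1 b x) by rewrite !mulr_ge0 ?subr_ge0// ltW.
  by rewrite /M1'; lra.
have I1b0 x : 0 < I1 b x by have /andP[+ _] := I1_bnd mb x; exact: lt_le_trans.
have I1b'0 x : 0 < I1 b' x by have /andP[+ _] := I1_bnd mb' x; exact: lt_le_trans.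
have S1lo x : S1 b x <= M1' * S1 b' x.
  by rewrite /S1 ler_pdivlMr// mulrC ler_pdivrMr.
have S1hi x : m1' * S1 b' x <= S1 b x.
  by rewrite /S1 ler_pdivrMr// mulrC ler_pdivlMr.
have bS := bS1 mb; have bS' := bS1 mb'.
have K0 z : 0 <= K z by exact: le_trans (ltW e0) (eK z).
have I2lo y : I2 (S1 b) y <= M1' * I2 (S1 b') y.
  rewrite /I2 -bmeas_RintegralZl; last exact: bmeasM.
  apply: bmeas_le_Rintegral; first exact: bmeasM.
    by apply: bmeasM; [exact: bmeas_cst|exact: bmeasM].
  by move=> x; rewrite mulrCA ler_wpM2l.
have I2hi y : m1' * I2 (S1 b') y <= I2 (S1 b) y.
  rewrite /I2 -bmeas_RintegralZl; last exact: bmeasM.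
  apply: bmeas_le_Rintegral; last 2 first.
  - exact: bmeasM.
  - by move=> x; rewrite mulrCA ler_wpM2l.
  by apply: bmeasM; [exact: bmeas_cst|exact: bmeasM].
have Flo y : m1' * F b y <= F b' y.
  rewrite /F ler_pdivrMr ?I2_gt0// mulrC ler_pdivlMr ?I2_gt0//.
have Fhi y : F b' y <= M1' * F b y.
  by rewrite /F ler_pdivlMr ?I2_gt0// mulrC ler_pdivrMr ?I2_gt0.
have l0 := lam_gt0 mb; have l0' := lam_gt0 mb'.
pose rho := lam b' / lam b.
have rho0 : 0 < rho by rewrite divr_gt0.
have NE y : N b' y = F b' y / rho / lam b.
  rewrite /N /rho; move: (lam b) (lam b') (F b' y) l0 l0' => l l' Fy l0 l0'.
  by field; rewrite !gt_eqF.
exists (m1' / rho), (M1' / rho); split; first by rewrite divr_gt0.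
  move=> y; rewrite NE /N !mulrA; apply/andP; split;
    rewrite ler_wpM2r ?invr_ge0 ?(ltW l0)// mulrAC ler_wpM2r// ?invr_ge0 ?ltW//.
have -> : M1' / rho / (m1' / rho) - 1 = (1 - e) * ((M - m) / m1').
  have M1'E : M1' = m1' + (1 - e) * (M - m) by rewrite /M1' /m1'; ring.
  rewrite M1'E; move: (rho) (m1') rho0 m1'0 => r l r0 l0''.
  by field; rewrite !gt_eqF.
have -> : M / m - 1 = (M - m) / m by field; rewrite gt_eqF.
rewrite ler_wpM2l ?subr_ge0// ler_wpM2l ?subr_ge0 ?(le_trans m1)//.
by rewrite lef_pV2.
Qed.

(* Since both scalings have mean one, [m <= 1 <= M]. *)
Let ratio_dist b b' (m M : R) : mean1 b -> mean1 b' -> 0 < m ->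
  (forall y, m * b y <= b' y <= M * b y) ->
  forall y, `|b' y - b y| <= (M / m - 1) * e^-1.
Proof.
move=> [bb be b1] [bb' be' b1'] m0 mM y.
have Rbb' k : \int[nu]_y (k * b y) = k by rewrite bmeas_RintegralZl// b1 mulr1.
have bkb k : bmeas (fun y => k * b y) by apply: bmeasM => //; exact: bmeas_cst.
have m1 : m <= 1.
  rewrite -(Rbb' m) -b1'; apply: bmeas_le_Rintegral => // z.
  by case/andP: (mM z).
have M1 : 1 <= M.
  rewrite -(Rbb' M) -b1'; apply: bmeas_le_Rintegral => // z.
  by case/andP: (mM z).
have -> : M / m - 1 = (M - m) / m by field; rewrite gt_eqF.
have Mm : M - m <= (M - m) / m.
  by rewrite ler_pdivlMr// ler_piMr// subr_ge0 (le_trans m1).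
have /andP[y1 y2] := mM y; have /andP[by1 by2] := be y.
have b0 : 0 <= b y by exact: le_trans (ltW e0) by1.
apply: (@le_trans _ _ ((M - m) * b y)).
  have : 0 <= (M - 1) * b y by rewrite mulr_ge0// subr_ge0.
  have : 0 <= (1 - m) * b y by rewrite mulr_ge0// subr_ge0.
  by rewrite ler_norml => ? ?; apply/andP; split; lra.
by apply: ler_pM => //; rewrite subr_ge0 (le_trans m1).
Qed.

(** Schrodinger system for a kernel with values in [e, 1]: positive scalings
    [a], [b] turning [K] into a density with both marginals equal to one. *)
Lemma schrodinger_system : exists a b, [/\ bmeas a, bmeas b,
    (forall x, 1 <= a x <= e^-1), (forall y, e <= b y <= e^-1) &
    (forall x, a x * \int[nu]_y (K (x, y) * b y) = 1) /\
    (forall y, b y * \int[mu]_x (K (x, y) * a x) = 1)].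
Proof.
have e1' := e1.
have ei0 : 0 < e^-1 by rewrite invr_gt0.
have ei1 : 1 <= e^-1 by rewrite invf_ge1.
pose bk k := iter k N (fun=> 1).
have mbk k : mean1 (bk k).
  elim: k => [|k IH]; last exact: mean1N.
  split; [exact: bmeas_cst|by move=> y; rewrite e1' ei1|].
  exact: Rintegral_probability_cst.
pose w0 := e^-1 / e - 1.
have w00 : 0 <= w0 by rewrite subr_ge0 ler_pdivlMr// mul1r (le_trans e1').
have ratios k : exists m M, [/\ 0 < m,
    forall y, m * bk k y <= bk k.+1 y <= M * bk k y &
    M / m - 1 <= w0 * (1 - e) ^+ k].
  elim: k => [|k [m [M [m0 mM w]]]].
    exists e, e^-1; split => //; last by rewrite expr0 mulr1.
    by move=> y; have [_ h _] := mbk 1%N; rewrite !mulr1; exact: h.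
  have [m' [M' [m'0 mM' w']]] := contraction (mbk k) (mbk k.+1) m0 mM.
  exists m', M'; split => //; apply: (le_trans w').
  by rewrite exprS mulrCA ler_wpM2l// subr_ge0.
pose C := w0 / e / (1 - (1 - e)).
have q0 : 0 <= 1 - e by rewrite subr_ge0.
have q1 : 1 - e < 1 by rewrite gtrBl.
have /choice[b bE] : forall y, exists l, forall k, `|l - bk k y| <= C * (1 - e) ^+ k.
  move=> y.
  apply: geometric_limit => // [|k].
    by rewrite divr_ge0// ltW.
  have [m [M [m0 mM w]]] := ratios k.
  apply: (le_trans (ratio_dist (mbk k) (mbk k.+1) m0 mM y)).
  by rewrite mulrAC ler_wpM2r// ltW.
have C0 : 0 <= C by rewrite /C opprB addrC subrK !divr_ge0// ltW.
have b_bnd y : e <= b y <= e^-1.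
  apply/andP; split; rewrite -subr_le0; apply: (geometric_le0 q0 q1 (C := C)) => k;
    have := bE y k; have [_ /(_ y) /andP[? ?] _] := mbk k;
    by rewrite ler_norml => /andP[? ?]; lra.
have bb : bmeas b.
  split; last first.
    exists e^-1 => y; have /andP[b1 b2] := b_bnd y; rewrite ger0_norm//.
    by apply: le_trans b1; exact: ltW.
  apply: (@measurable_fun_cvg _ _ _ setT bk) => //.
    by move=> k; case: (mbk k) => -[].
  move=> y _; apply/cvgrPdist_le => eps eps0.
  have q1n : `|1 - e| < 1 by rewrite ger0_norm.
  have /cvgrPdist_le/(_ _ eps0) := cvg_geometric C q1n.
  apply: filterS => k /=; rewrite sub0r normrN => h.
  exact: le_trans (bE y k) (le_trans (ler_norm _) h).
have b1 : \int[nu]_y b y = 1.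
  apply/eqP; rewrite -subr_eq0 -normr_le0.
  apply: (geometric_le0 q0 q1 (C := C)) => k.
  have [bbk _ bk1] := mbk k; rewrite -[X in _ - X]bk1 -bmeas_RintegralB//.
  by apply: normr_Rintegral_le => [|y]; [exact: bmeasB|exact: bE].
have mb : mean1 b by split.
have Nb y : N b y = b y.
  apply/eqP; rewrite -subr_eq0 -normr_le0.
  have Ce0 : 0 <= C / e by rewrite divr_ge0// ltW.
  (* Contraction applied to [bk j] and [b], for [j] so large that the lower
     ratio [1 - s] stays away from zero. *)
  have [k0 k0P] : exists k0, C / e * (1 - e) ^+ k0 <= 2^-1.
    apply: contrapT => /forallNP h.
    have : (2^-1 : R) <= 0.
      by apply: (geometric_le0 q0 q1 (C := C / e)) => k; apply/ltW; rewrite ltNge; exact/negP.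
    by lra.
  apply: (geometric_le0 q0 q1 (C := (4 * (C / e) / e + C))) => k.
  pose j := (k0 + k)%N; pose s := C / e * (1 - e) ^+ j.
  have s0 : 0 <= s by rewrite mulr_ge0 ?exprn_ge0.
  have sk : s <= C / e * (1 - e) ^+ k.
    rewrite ler_wpM2l// /j addnC exprD ler_piMr ?exprn_ge0//.
    by rewrite exprn_ile1// ltW.
  have s2 : s <= 2^-1.
    apply: le_trans k0P.
    rewrite ler_wpM2l// /j exprD ler_piMr ?exprn_ge0//.
    by rewrite exprn_ile1// ltW.
  have sm : 0 < 1 - s by lra.
  have smM z : (1 - s) * bk j z <= b z <= (1 + s) * bk j z.
    have [_ /(_ z)/andP[bz _] _] := mbk j.
    have sb : C * (1 - e) ^+ j <= s * bk j z.
      have -> : C * (1 - e) ^+ j = s * e by rewrite /s; field; rewrite gt_eqF.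
      by rewrite ler_wpM2l.
    by have := bE z j; rewrite ler_norml => /andP[? ?]; apply/andP; split; lra.
  have [m' [M' [m'0 mM' w']]] := contraction (mbk j) mb sm smM.
  have := ratio_dist (mbk j.+1) (mean1N mb) m'0 mM' y.
  have w4 : M' / m' - 1 <= 4 * s.
    apply: (le_trans w').
    have -> : (1 + s) / (1 - s) - 1 = 2 * s / (1 - s) by field; rewrite gt_eqF.
    apply: (@le_trans _ _ (2 * s / (1 - s))).
      have s20 : 0 <= 2 * s / (1 - s) by apply: divr_ge0; [exact: mulr_ge0|exact: ltW].
      by rewrite ler_piMl// gerBl ltW.
    by rewrite ler_pdivrMr//; nra.
  move=> h1; have h2 := bE y j.+1.
  have h3 : C * (1 - e) ^+ j.+1 <= C * (1 - e) ^+ k.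
    rewrite ler_wpM2l// /j -addSn addnC exprD ler_piMr ?exprn_ge0//.
    by rewrite exprn_ile1// ltW.
  have h4 : (M' / m' - 1) / e <= 4 * (C / e * (1 - e) ^+ k) / e.
    by rewrite ler_wpM2r ?(ltW ei0)//; lra.
  have -> : N b y - b y = (N b y - bk j.+1 y) - (b y - bk j.+1 y) by lra.
  apply: (le_trans (ler_normB _ _)).
  have -> : (4 * (C / e) / e + C) * (1 - e) ^+ k =
    4 * (C / e * (1 - e) ^+ k) / e + C * (1 - e) ^+ k by lra.
  exact: lerD (le_trans h1 h4) (le_trans h2 h3).
have bS := bS1 mb.
have FE y : F b y = lam b * b y.
  by rewrite -[X in _ * X](Nb y) /N mulrC divfK// gt_eqF// lam_gt0.
have eq1 x : S1 b x * I1 b x = 1.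
  rewrite /S1 mulVf// gt_eqF//.
  by have /andP[+ _] := I1_bnd mb x; exact: lt_le_trans.
have eq2 y : lam b * b y * I2 (S1 b) y = 1.
  by rewrite -FE /F mulVf// gt_eqF// I2_gt0.
(* Both sides of the system integrate to the mass of [K a b]. *)
have lam1 : lam b = 1.
  pose k z := K z * S1 b z.1 * b z.2.
  have bk' : bmeas k.
    apply: bmeasM; last exact: (bmeas_comp measurable_snd).
    by apply: bmeasM => //; exact: (bmeas_comp measurable_fst).
  have k1 : \int[(mu \x nu)%E]_z k z = 1.
    rewrite (bmeas_Rintegral_prod12 mu nu bk').
    rewrite -[RHS](Rintegral_probability_cst mu); apply: eq_Rintegral => x _.
    rewrite -(eq1 x) /I1 -bmeas_RintegralZl; last exact: bmeasM.
    by apply: eq_Rintegral => y _; rewrite /k/=; ring.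
  have : \int[(mu \x nu)%E]_z k z = (lam b)^-1.
    rewrite (bmeas_Rintegral_prod21 mu nu bk').
    rewrite -[RHS](Rintegral_probability_cst nu); apply: eq_Rintegral => y _.
    have -> : (lam b)^-1 = b y * I2 (S1 b) y.
      by rewrite -[RHS]mul1r -(mulVf (lt0r_neq0 (lam_gt0 mb))) -!mulrA [lam b * _]mulrA eq2 mulr1.
    rewrite /I2 -bmeas_RintegralZl; last exact: bmeasM.
    by apply: eq_Rintegral => x _; rewrite /k/=; ring.
  by rewrite k1 => /(congr1 (@GRing.inv R)); rewrite invrK invr1.
exists (S1 b), b; split => //.
  exact: S1_bnd.
by split=> // y; rewrite -(eq2 y) lam1 mul1r.
Qed.

End sinkhorn.

(** * The Schrodinger coupling has the Schrodinger density *)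

Section gibbs_variational.
Context d (Z : measurableType d) (R : realType).
Variables (pi Q : probability Z R) (p : Z -> R) (e : R).
Hypotheses (bp : bmeas p) (e0 : 0 < e) (ep : forall z, e <= p z).
Hypothesis p1 : \int[Q]_z p z = 1.
Hypothesis dom : pi `<< Q.

(* A nonnegative version of the density of [pi] with respect to [Q]. *)
Let r z := fine (Radon_Nikodym_SigmaFinite.f pi Q z).

Let p_gt0 z : 0 < p z. Proof. exact: lt_le_trans (ep z). Qed.

Let mf : measurable_fun setT (Radon_Nikodym_SigmaFinite.f pi Q).
Proof. exact: measurable_int (Radon_Nikodym_SigmaFinite.f_integrable dom). Qed.

Let mr : measurable_fun setT r.
Proof. exact: measurableT_comp. Qed.

Let r_ge0 z : 0 <= r z.
Proof. by rewrite fine_ge0// Radon_Nikodym_SigmaFinite.f_ge0. Qed.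

Let rE z : Radon_Nikodym_SigmaFinite.f pi Q z = (r z)%:E.
Proof. by rewrite fineK// Radon_Nikodym_SigmaFinite.f_fin_num. Qed.

Let piE A : measurable A -> pi A = (\int[Q]_(z in A) (r z)%:E)%E.
Proof.
move=> mA; rewrite (Radon_Nikodym_SigmaFinite.f_integral dom)//.
by apply: eq_integral => z _; rewrite rE.
Qed.

(* [phi = p / r], with value 0 where [r] vanishes. *)
Let phi z := p z * (r z)^-1.

Let mp : measurable_fun setT p. Proof. by case: bp. Qed.

Let mphi : measurable_fun setT phi.
Proof.
apply: measurable_funM => //.
rewrite (_ : (fun _ => _) = (fun y => y `^ -1) \o r).
  by apply: measurableT_comp => //; exact: measurable_powR.
by apply/funext => z; rewrite /= powR_inv1.
Qed.

Let phi_ge0 z : 0 <= phi z.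
Proof. by rewrite mulr_ge0 ?invr_ge0// ltW. Qed.

Let int_phi_le1 : (\int[pi]_z (phi z)%:E <= 1)%E.
Proof.
rewrite -(Radon_Nikodym_SigmaFinite.change_of_variables dom)//; last exact/measurable_EFinP.
apply: (@le_trans _ _ (\int[Q]_z (p z)%:E)%E); last first.
  by rewrite bmeas_RintegralE// p1.
apply: ge0_le_integral => //.
- by move=> z _; rewrite rE -EFinM lee_fin mulr_ge0.
- by apply: emeasurable_funM => //; exact/measurable_EFinP.
- exact/measurable_EFinP.
- move=> z _; rewrite rE -EFinM lee_fin /phi.
  have [->|r0] := eqVneq (r z) 0; first by rewrite mulr0 ltW.
  by rewrite divfK.
Qed.

Let int_phi : pi.-integrable setT (EFin \o phi).
Proof.
apply/integrableP; split; first exact/measurable_EFinP.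
apply: (@le_lt_trans _ _ 1%E); last exact: ltry.
apply: le_trans int_phi_le1; rewrite le_eqVlt; apply/orP; left; apply/eqP.
by apply: eq_integral => z _; rewrite /= ger0_norm.
Qed.

Let bln : bmeas (fun z => ln (p z)). Proof. exact: bmeas_ln ep bp. Qed.

(* The integrable lower bound of [ln r] given by [ln x <= x - 1]. *)
Let B z := ln (p z) + 1 - phi z.

Let int_B : pi.-integrable setT (EFin \o B).
Proof.
have -> : EFin \o B = ((EFin \o (fun z => (ln (p z) + 1)%R)) \- (EFin \o phi))%E by [].
apply: integrableB => //.
by apply: bmeas_integrable; apply: bmeasD => //; exact: bmeas_cst.
Qed.

Let r_gt0_ae : {ae pi, forall z, 0 < r z}.
Proof.
exists (r @^-1` [set 0]); split.
- by rewrite -[X in measurable X]setTI; exact: mr.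
- rewrite piE; last by rewrite -[X in measurable X]setTI; exact: mr.
  rewrite (eq_integral (cst 0%E)) ?integral0// => z; rewrite inE/= => ->//.
- move=> z /= /negP; rewrite -leNgt => rz; apply/eqP.
  by rewrite eq_le rz r_ge0.
Qed.

Let ln_ge_B z : 0 < r z -> B z <= ln (r z).
Proof.
move=> r0; have : ln (phi z) <= phi z - 1.
  have -> : phi z = 1 + (phi z - 1) by lra.
  rewrite [X in _ <= X - 1](_ : _ = phi z) ?le_ln1Dx//; last by lra.
  by rewrite ltrBrDl subrr divr_gt0.
by rewrite /phi ln_div ?posrE// /B /phi; lra.
Qed.

(* Equal to [ln r] where [r > 0], hence almost everywhere, but bounded below
   by [B] everywhere. *)
Let L z := Num.max (ln (r z)) (B z).

Let mL : measurable_fun setT L.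
Proof.
apply: measurable_maxr; first exact: measurableT_comp.
by apply/measurable_EFinP; exact: (measurable_int _ int_B).
Qed.

(** Gibbs' variational principle: a probability measure whose relative entropy
    does not exceed the integral of [ln p] has density [p].  This is the strict
    inequality [ln x < x - 1] for [x != 1] applied to the density ratio. *)
Lemma gibbs_variational :
  (\int[pi]_z (ln (r z))%:E <= \int[pi]_z (ln (p z))%:E)%E ->
  forall A, measurable A -> pi A = (\int[Q]_(z in A) (p z)%:E)%E.
Proof.
move=> hle.
have LE : (\int[pi]_z (ln (r z))%:E = \int[pi]_z (L z)%:E)%E.
  apply: ae_eq_integral => //.
  - by apply/measurable_EFinP; exact: measurableT_comp.
  - exact/measurable_EFinP.
  - apply: filterS r_gt0_ae => z rz _; congr EFin.
    by rewrite /L; apply/esym/max_idPl; exact: ln_ge_B.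
rewrite LE (bmeas_RintegralE pi bln) in hle.
have BL z : B z <= L z by rewrite /L le_max lexx orbT.
have int_L : pi.-integrable setT (EFin \o L).
  have mL' : measurable_fun setT (EFin \o L) by exact/measurable_EFinP.
  have negfin : (\int[pi]_z (EFin \o L)^\- z < +oo)%E.
    apply: le_lt_trans (integral_funeneg_lt_pinfty measurableT int_B).
    apply: ge0_le_integral => //.
    + exact: measurable_funeneg.
    + by apply: measurable_funeneg; exact: (measurable_int _ int_B).
    + move=> z _; rewrite !funenegE/= -!EFin_max lee_fin ge_max !le_max.
      by rewrite lexx orbT lerN2 BL.
  have negfin' : (\int[pi]_z (EFin \o L)^\- z)%E \is a fin_num.
    by rewrite ge0_fin_numE// integral_ge0.
  have posfin : (\int[pi]_z (EFin \o L)^\+ z < +oo)%E.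
    rewrite ltey; apply/eqP => posoo; move: hle.
    rewrite (_ : (\int[pi]_z (L z)%:E = \int[pi]_z (EFin \o L)^\+ z -
      \int[pi]_z (EFin \o L)^\- z)%E); last exact: integralE.
    by rewrite posoo addye ?leye_eq// -(fineK negfin') -EFinN.
  apply/integrableP; split => //.
  rewrite (eq_integral (fun z => (EFin \o L)^\+ z + (EFin \o L)^\- z)%E); last first.
    by move=> z _; exact: (congr1 (@^~ z) (fune_abse (EFin \o L))).
  rewrite ge0_integralD//; first exact: lte_add_pinfty.
  - exact: measurable_funepos.
  - exact: measurable_funeneg.
pose G z := L z - B z.
have intG : pi.-integrable setT (EFin \o G).
  by rewrite (_ : _ \o _ = ((EFin \o L) \- (EFin \o B))%E)//; exact: integrableB.
have G0 : (\int[pi]_z (EFin \o G) z <= 0)%E.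
  have [f fE] : exists f, (\int[pi]_z (EFin \o phi) z = f%:E)%E.
    by exists (fine (\int[pi]_z (EFin \o phi) z)); rewrite fineK//; exact: integrable_fin_num.
  have [l lE] : exists l, (\int[pi]_z (EFin \o L) z = l%:E)%E.
    by exists (fine (\int[pi]_z (EFin \o L) z)); rewrite fineK//; exact: integrable_fin_num.
  have b1 : bmeas (fun z => ln (p z) + 1) by apply: bmeasD => //; exact: bmeas_cst.
  have BE : (\int[pi]_z (EFin \o B) z = (\int[pi]_z (ln (p z)) + 1 - f)%:E)%E.
    rewrite (_ : _ \o B = ((EFin \o (fun z => (ln (p z) + 1)%R)) \- (EFin \o phi))%E)//.
    rewrite integralB//; last exact: bmeas_integrable.
    rewrite fE EFinB; congr (_ - _)%E.
    rewrite [LHS](bmeas_RintegralE pi b1) bmeas_RintegralD//; last exact: bmeas_cst.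
    by rewrite Rintegral_probability_cst.
  have h1 : l <= \int[pi]_z (ln (p z)) by rewrite -lee_fin -lE.
  have h2 : f <= 1 by rewrite -lee_fin -fE.
  rewrite (_ : _ \o G = ((EFin \o L) \- (EFin \o B))%E)// integralB// lE BE.
  by rewrite -EFinB lee_fin; lra.
have Gae : {ae pi, forall z, G z = 0}.
  have : ae_eq pi setT (EFin \o G) (cst 0%E).
    apply/ae_eq_integral_abs => //; first exact: (measurable_int _ intG).
    apply/eqP; rewrite eq_le integral_ge0// andbT; apply: le_trans G0.
    rewrite le_eqVlt; apply/orP; left; apply/eqP; apply: eq_integral => z _.
    by rewrite /= ger0_norm// subr_ge0.
  by apply: filterS => z /(_ I) [].
have rp : {ae pi, forall z, r z = p z}.
  apply: filterS2 r_gt0_ae Gae => z rz Gz.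
  have phi0 : 0 < phi z by rewrite divr_gt0.
  have lnphi : ln (phi z) = phi z - 1.
    move: Gz; rewrite /G /L (max_idPl (ln_ge_B rz)) /B.
    by rewrite {3}/phi ln_div ?posrE// /phi; lra.
  have : ln (phi z) = 0.
    apply: contrapT => /eqP /expR_gt1Dx; rewrite lnK ?posrE// lnphi.
    by rewrite addrC subrK ltxx.
  move/eqP; rewrite ln_eq0// /phi => /eqP h.
  by rewrite -[LHS]mul1r -h divfK// gt_eqF.
have piA A : measurable A -> (pi A <= \int[Q]_(z in A) (p z)%:E)%E.
  move=> mA.
  have mrp : measurable [set z | r z = p z].
    have := measurable_fun_eqr mr mp.
    move=> /(_ measurableT [set true])/=; rewrite setTI => h.
    rewrite (_ : [set _ | _] = (fun x => r x == p x) @^-1` [set true]); first exact: h.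
    by apply/seteqP; split => z /=; [move=> ->; exact: eqxx|move/eqP].
  have rp0 : pi (~` [set z | r z = p z]) = 0%E.
    apply/eqP; rewrite eq_le measure_ge0 andbT.
    case: rp => N [mN N0 sub]; rewrite -N0; apply: le_measure; rewrite ?inE//.
    exact: measurableC.
  apply: (@le_trans _ _ (pi (A `&` [set z | r z = p z]))).
    rewrite -[leRHS]adde0 -rp0.
    apply: le_trans (measureU2 _ _ _) => //; last exact: measurableC; last exact: measurableI.
    apply: le_measure; rewrite ?inE//.
      by apply: measurableU; [exact: measurableI|exact: measurableC].
    by move=> z Az; have [|] := pselect (r z = p z) => h; [left|right].
  rewrite piE; last exact: measurableI.
  rewrite (eq_integral (fun z => (p z)%:E)); last first.
    by move=> z; rewrite inE => -[_ /= ->].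
  apply: ge0_subset_integral => //.
  - exact: measurableI.
  - by apply/measurable_EFinP; exact: measurable_funTS.
  - by move=> z _; rewrite lee_fin ltW.
move=> A mA; apply/eqP; rewrite eq_le piA//=.
have intp C : measurable C -> (\int[Q]_(z in C) (p z)%:E)%E \is a fin_num.
  move=> mC; apply: integrable_fin_num => //.
  by apply: (integrableS measurableT) => //; exact: bmeas_integrable.
have pisum : (pi A + pi (~` A) = 1)%E by rewrite probability_setC// addeC subeK// fin_num_measure.
have psum : (\int[Q]_(z in A) (p z)%:E + \int[Q]_(z in ~` A) (p z)%:E = 1)%E.
  rewrite -ge0_integral_setU//.
  - by rewrite setUv bmeas_RintegralE// p1.
  - exact: measurableC.
  - by rewrite setUv; exact/measurable_EFinP.
  - by move=> z _; rewrite lee_fin ltW.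
  - by apply/disj_setPS => z [].
have := piA _ (measurableC mA).
move: pisum psum.
have /fineK <- := intp _ mA; have /fineK <- := intp _ (measurableC mA).
have /fineK <- := fin_num_measure pi _ mA.
have /fineK <- := fin_num_measure pi _ (measurableC mA).
by move=> [h1] [h2]; rewrite !lee_fin; lra.
Qed.

End gibbs_variational.

(** A bounded density of total mass one, as a probability measure. *)
Definition pdensity d (T : measurableType d) (R : realType)
    (mu : {finite_measure set T -> \bar R}) (p : T -> R)
    (bp : bmeas p) (p0 : forall x, 0 <= p x) (p1 : \int[mu]_x p x = 1) :
  set T -> \bar R := density mu bp p0.

Section pdensity.
Context d (T : measurableType d) (R : realType).
Variables (mu : {finite_measure set T -> \bar R}) (p : T -> R).
Variables (bp : bmeas p) (p0 : forall x, 0 <= p x) (p1 : \int[mu]_x p x = 1).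

HB.instance Definition _ := Measure.on (pdensity bp p0 p1).

Let pdensity_setT : pdensity bp p0 p1 setT = 1%E.
Proof. by rewrite /pdensity /density bmeas_RintegralE// p1. Qed.

HB.instance Definition _ :=
  Measure_isProbability.Build _ _ _ (pdensity bp p0 p1) pdensity_setT.

End pdensity.

Section truncated_kernel.
Context (R : realType) (eta : R) (d : nat).
Hypothesis eta0 : 0 < eta.
Local Notation V := (d.-tuple R).

Lemma sqdist_ge0 (x y : V) : 0 <= sqdist x y.
Proof. by apply: sumr_ge0 => i _; exact: sqr_ge0. Qed.

Lemma sqdist_le1 (x y : V) : enorm x <= 2^-1 -> enorm y <= 2^-1 -> sqdist x y <= 1.
Proof.
have sq (z : V) : enorm z <= 2^-1 -> \sum_(i < d) tnth z i ^+ 2 <= 4^-1.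
  have z0 : 0 <= \sum_(i < d) tnth z i ^+ 2 by apply: sumr_ge0 => i _; exact: sqr_ge0.
  move=> ez; rewrite -(sqr_sqrtr z0).
  have -> : (4^-1 : R) = 2^-1 ^+ 2 by lra.
  by rewrite ler_sqr// nnegrE// sqrtr_ge0.
move=> /sq hx /sq hy; rewrite /sqdist.
apply: (@le_trans _ _ (2 * (\sum_(i < d) tnth x i ^+ 2) + 2 * (\sum_(i < d) tnth y i ^+ 2))).
  rewrite !mulr_sumr -big_split/=; apply: ler_sum => i _.
  by have := sqr_ge0 (tnth x i + tnth y i); nra.
by lra.
Qed.

Lemma measurable_sqdist : measurable_fun setT (fun z : V * V => sqdist z.1 z.2).
Proof.
apply: measurable_sum => i; apply: measurable_funX; apply: measurable_funB.
  exact: (measurableT_comp (measurable_tnth i) measurable_fst).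
exact: (measurableT_comp (measurable_tnth i) measurable_snd).
Qed.

(** The cost is truncated at 1, an upper bound of it on the supports, so that it
    is bounded everywhere. *)
Definition tcost (z : V * V) : R := Num.min (sqdist z.1 z.2) 1.

(** The Gibbs kernel of the truncated cost, with values in [e^(-eta), 1]. *)
Definition tkernel (z : V * V) : R := expR (- eta * tcost z).

Lemma tcost_sqdist (x y : V) : enorm x <= 2^-1 -> enorm y <= 2^-1 ->
  tcost (x, y) = sqdist x y.
Proof. by move=> hx hy; apply/min_idPl; exact: sqdist_le1. Qed.

Lemma bmeas_tcost : bmeas tcost.
Proof.
split; first by apply: measurable_minr => //; exact: measurable_sqdist.
exists 1 => z; rewrite ger0_norm; first by rewrite ge_min lexx orbT.
by rewrite le_min sqdist_ge0/=.
Qed.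

Lemma bmeas_tkernel : bmeas tkernel.
Proof. by apply: bmeas_expR; apply: bmeasM; [exact: bmeas_cst|exact: bmeas_tcost]. Qed.

Lemma tkernel_ge z : expR (- eta) <= tkernel z.
Proof.
rewrite ler_expR mulNr lerN2 ler_piMr ?(ltW eta0)//.
by rewrite /tcost ge_min lexx orbT.
Qed.

Lemma tkernel_le1 z : tkernel z <= 1.
Proof.
rewrite -[leRHS]expR0 ler_expR mulNr oppr_le0 mulr_ge0 ?(ltW eta0)//.
by rewrite le_min sqdist_ge0/=.
Qed.

End truncated_kernel.

Lemma coupling_fst_Rintegral d1 d2 (T : measurableType d1) (U : measurableType d2)
    (R : realType) (mu : probability T R) (nu : probability U R)
    (pi : probability (T * U)%type R) (f : T -> R) :
  coupling mu nu pi -> bmeas f -> \int[pi]_z f z.1 = \int[mu]_x f x.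
Proof.
move=> [c1 _] bf; apply/esym/bmeas_Rintegral_pushforward => // B mB.
apply: (etrans (esym (c1 _ mB))); congr (pi _); apply/seteqP.
by split => z //= -[].
Qed.

Lemma coupling_snd_Rintegral d1 d2 (T : measurableType d1) (U : measurableType d2)
    (R : realType) (mu : probability T R) (nu : probability U R)
    (pi : probability (T * U)%type R) (f : U -> R) :
  coupling mu nu pi -> bmeas f -> \int[pi]_z f z.2 = \int[nu]_y f y.
Proof.
move=> [_ c2] bf; apply/esym/bmeas_Rintegral_pushforward => // B mB.
apply: (etrans (esym (c2 _ mB))); congr (pi _); apply/seteqP.
by split => z //= -[].
Qed.

Section sdensity.
Context (R : realType) (eta : R) (d : nat).
Hypothesis eta0 : 0 < eta.
Local Notation V := (d.-tuple R).
Local Notation e := (expR (- eta)).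
Variables (mu nu : probability V R) (a b : V -> R).
Hypotheses (ba : bmeas a) (bb : bmeas b).
Hypotheses (aE : forall u, 1 <= a u <= e^-1) (bE : forall v, e <= b v <= e^-1).
Hypothesis ab1 : forall x, a x * \int[nu]_y (tkernel eta (x, y) * b y) = 1.
Hypothesis ab2 : forall y, b y * \int[mu]_x (tkernel eta (x, y) * a x) = 1.

(** The Schrodinger density: the truncated Gibbs kernel with scalings
    [a = e^(eta f)] and [b = e^(eta g)]. *)
Definition sdensity (z : V * V) : R := tkernel eta z * a z.1 * b z.2.

Let e0 : 0 < e. Proof. exact: expR_gt0. Qed.

Let a0 u : 0 < a u.
Proof. by have /andP[+ _] := aE u; apply: lt_le_trans. Qed.

Let b0 u : 0 < b u.
Proof. by have /andP[+ _] := bE u; apply: lt_le_trans. Qed.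

Lemma sdensity_gt0 z : 0 < sdensity z.
Proof. by rewrite /sdensity !mulr_gt0 ?expR_gt0. Qed.

Lemma sdensity_bounds z : e ^+ 2 <= sdensity z <= e^-1 ^+ 2.
Proof.
have /andP[a1 a2] := aE z.1; have /andP[b1 b2] := bE z.2.
have K0 := tkernel_ge eta0 z; have K1 := tkernel_le1 eta0 z.
have Kge0 : 0 <= tkernel eta z by exact: le_trans (ltW e0) K0.
rewrite /sdensity !expr2; apply/andP; split.
  rewrite -[X in X * _]mulr1 !ler_pM// ?mulr_ge0 ?ltW//.
have h : tkernel eta z * a z.1 <= e^-1 by rewrite -[leRHS]mul1r ler_pM// ltW.
by rewrite ler_pM// ?mulr_ge0// ltW.
Qed.

Lemma bmeas_sdensity : bmeas sdensity.
Proof.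
apply: bmeasM; last exact: (bmeas_comp measurable_snd).
by apply: bmeasM; [exact: bmeas_tkernel|exact: (bmeas_comp measurable_fst)].
Qed.

Lemma sdensity_row x : \int[nu]_y sdensity (x, y) = 1.
Proof.
rewrite -(ab1 x) -bmeas_RintegralZl; last first.
  by apply: bmeasM => //; exact: (bmeas_section1 (bmeas_tkernel eta d)).
by apply: eq_Rintegral => y _; rewrite /sdensity/=; ring.
Qed.

Lemma sdensity_col y : \int[mu]_x sdensity (x, y) = 1.
Proof.
rewrite -(ab2 y) -bmeas_RintegralZl; last first.
  by apply: bmeasM => //; exact: (bmeas_section2 (bmeas_tkernel eta d)).
by apply: eq_Rintegral => x _; rewrite /sdensity/=; ring.
Qed.

End sdensity.

Section schrodinger_density.
Context (R : realType) (eta : R) (d : nat).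
Hypothesis eta0 : 0 < eta.
Local Notation V := (d.-tuple R).
Local Notation e := (expR (- eta)).
Variables (mu nu : probability V R).
Hypotheses (mu_bounded : {ae mu, forall x, enorm x <= 2^-1})
  (nu_bounded : {ae nu, forall y, enorm y <= 2^-1}).
Variables (a b : V -> R).
Hypotheses (ba : bmeas a) (bb : bmeas b).
Hypotheses (aE : forall u, 1 <= a u <= e^-1) (bE : forall v, e <= b v <= e^-1).
Hypothesis ab1 : forall x, a x * \int[nu]_y (tkernel eta (x, y) * b y) = 1.
Hypothesis ab2 : forall y, b y * \int[mu]_x (tkernel eta (x, y) * a x) = 1.

Local Notation p := (sdensity eta a b).

Let bp := bmeas_sdensity eta ba bb.

Let e0 : 0 < e. Proof. exact: expR_gt0. Qed.
Let e20 : 0 < e ^+ 2. Proof. exact: exprn_gt0. Qed.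

Let a0 x : 0 < a x.
Proof. by have /andP[+ _] := aE x; apply: lt_le_trans. Qed.

Let b0 x : 0 < b x.
Proof. by have /andP[+ _] := bE x; apply: lt_le_trans. Qed.

Let ep z : e ^+ 2 <= p z.
Proof. by case/andP: (sdensity_bounds eta0 aE bE z). Qed.

Let p0 z : 0 <= p z. Proof. exact/ltW/sdensity_gt0. Qed.

Let pint1 := sdensity_row bb ab1.
Let pint2 := sdensity_col ba ab2.

Let Q : probability (V * V)%type R := (mu \x nu)%E.

Let pint : \int[Q]_z p z = 1.
Proof.
rewrite (bmeas_Rintegral_prod12 mu nu bp).
rewrite -[RHS](Rintegral_probability_cst mu).
by apply: eq_Rintegral => x _; rewrite pint1.
Qed.

(* The candidate coupling. *)
Let pi0 : probability (V * V)%type R := pdensity bp p0 pint.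

Let pi0E A : measurable A -> pi0 A = (\int[Q]_(z in A) (p z)%:E)%E.
Proof. by []. Qed.

Let Rintegral_pi0 (f : V * V -> R) : bmeas f ->
  \int[pi0]_z f z = \int[mu]_x \int[nu]_y (f (x, y) * p (x, y)).
Proof.
move=> bf; rewrite [LHS](has_density_Rintegral bp pi0E bf).
by rewrite (bmeas_Rintegral_prod12 mu nu (bmeasM bf bp)).
Qed.

Let coupling_pi0 : coupling mu nu pi0.
Proof.
split => A mA.
  rewrite !measure_Rintegral//; last exact: measurableX.
  congr EFin; rewrite Rintegral_pi0; last by apply: bmeas_indic; exact: measurableX.
  apply: eq_Rintegral => x _.
  rewrite -[RHS]mulr1 -(pint1 x) -bmeas_RintegralZl; last exact: bmeas_section1.
  by apply: eq_Rintegral => y _; rewrite !indicE in_setX in_setT andbT.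
rewrite !measure_Rintegral//; last exact: measurableX.
congr EFin; rewrite [LHS](has_density_Rintegral bp pi0E); last by apply: bmeas_indic; exact: measurableX.
rewrite (bmeas_Rintegral_prod21 mu nu); last first.
  by apply: bmeasM => //; apply: bmeas_indic; exact: measurableX.
apply: eq_Rintegral => y _.
rewrite -[RHS]mulr1 -(pint2 y) -bmeas_RintegralZl; last exact: bmeas_section2.
by apply: eq_Rintegral => x _; rewrite !indicE in_setX in_setT.
Qed.

Let coupling_cost (pi : probability (V * V)%type R) : coupling mu nu pi ->
  (\int[pi]_z (sqdist z.1 z.2)%:E)%E = (\int[pi]_z tcost z)%:E.
Proof.
move=> [c1 c2]; rewrite -bmeas_RintegralE; last exact: bmeas_tcost.
apply: ae_eq_integral => //.
- by apply/measurable_EFinP; exact: measurable_sqdist.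
- by apply/measurable_EFinP; case: (@bmeas_tcost R d).
have h1 : {ae pi, forall z, enorm z.1 <= 2^-1}.
  case: mu_bounded => N [mN N0 sub]; exists (N `*` setT); split.
  - exact: measurableX.
  - by rewrite -N0; exact: c1.
  - by move=> z hz; split => //; exact: sub.
have h2 : {ae pi, forall z, enorm z.2 <= 2^-1}.
  case: nu_bounded => N [mN N0 sub]; exists (setT `*` N); split.
  - exact: measurableX.
  - by rewrite -N0; exact: c2.
  - by move=> z hz; split => //; exact: sub.
apply: filterS2 h1 h2 => -[x y] /= hx hy _.
by rewrite tcost_sqdist.
Qed.

Let bln_a : bmeas (fun x => ln (a x)). Proof. exact: (bmeas_ln ltr01 (fun u => (andP (aE u)).1) ba). Qed.
Let bln_b : bmeas (fun x => ln (b x)). Proof. exact: (bmeas_ln e0 (fun u => (andP (bE u)).1) bb). Qed.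

Let coupling_lnp (pi : probability (V * V)%type R) : coupling mu nu pi ->
  \int[pi]_z ln (p z) =
  - eta * \int[pi]_z tcost z + \int[mu]_x ln (a x) + \int[nu]_y ln (b y).
Proof.
move=> cpi.
rewrite -(coupling_fst_Rintegral cpi bln_a) -(coupling_snd_Rintegral cpi bln_b).
have bc := @bmeas_tcost R d.
have b1 : bmeas (fun z : V * V => ln (a z.1)) by exact: (bmeas_comp measurable_fst bln_a).
have b2 : bmeas (fun z : V * V => ln (b z.2)) by exact: (bmeas_comp measurable_snd bln_b).
have b3 : bmeas (fun z : V * V => - eta * tcost z) by apply: bmeasM => //; exact: bmeas_cst.
rewrite -bmeas_RintegralZl// -!bmeas_RintegralD//; last exact: bmeasD.
apply: eq_Rintegral => z _; rewrite /sdensity lnM ?posrE ?mulr_gt0 ?expR_gt0//.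
by rewrite lnM ?posrE ?expR_gt0// expRK.
Qed.

Let blnp : bmeas (fun z => ln (p z)).
Proof. exact: bmeas_ln e20 ep bp. Qed.

Local Open Scope charge_scope.

Let dom0 : pi0 `<< Q. Proof. exact: has_density_dominates bp pi0E. Qed.

Let KL_pi0 : KL pi0 Q = (\int[pi0]_z ln (p z))%:E.
Proof.
rewrite /KL; case: asboolP => [_|/(_ dom0)//].
rewrite -bmeas_RintegralE//; apply: ae_eq_integral => //.
- by apply/measurable_EFinP; apply: measurableT_comp => //; exact: measurableT_comp.
- by apply/measurable_EFinP; case: blnp.
have := null_dominates_ae_eq measurableT dom0 (has_density_Radon_Nikodym bp pi0E).
by apply: filterS => z h _; rewrite -(h I).
Qed.

(** The Schrodinger coupling has density [K a b] with respect to the product of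
    its marginals: by optimality its relative entropy is at most the integral
    of [ln (K a b)], which takes the same value for all couplings up to the
    transport cost. *)
Lemma schrodinger_coupling_density (pi : probability (V * V)%type R) :
  schrodinger_coupling eta mu nu pi ->
  forall A, measurable A -> pi A = (\int[(mu \x nu)%E]_(z in A) (p z)%:E)%E.
Proof.
move=> [cpi opt].
have := opt _ coupling_pi0; rewrite /entropic_cost !coupling_cost//.
rewrite -[(mu \x nu)%E]/(Q : set _ -> _) KL_pi0 coupling_lnp//.
set c := \int[pi]_z tcost z; set c0 := \int[pi0]_z tcost z.
set D := \int[mu]_x _; set E := \int[nu]_x _.
have ei : 0 < eta^-1 by rewrite invr_gt0.
rewrite /KL; case: asboolP => [dom|_]; last first.
  by rewrite gt0_muley ?lte_fin// addey//.
move=> hle; apply: (@gibbs_variational _ _ _ pi Q p _ bp e20 ep pint dom).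
rewrite (bmeas_RintegralE pi blnp) coupling_lnp//.
have <- : (\int[pi]_z (ln (fine (('d (charge_of_finite_measure pi) '/d Q) z)))%:E =
    \int[pi]_z (ln (fine (Radon_Nikodym_SigmaFinite.f pi Q z)))%:E)%E.
  apply: ae_eq_integral => //.
  - by apply/measurable_EFinP; apply: measurableT_comp => //; exact: measurableT_comp.
  - apply/measurable_EFinP; do 2 apply: measurableT_comp => //.
    exact: measurable_int (Radon_Nikodym_SigmaFinite.f_integrable dom).
  - have := null_dominates_ae_eq measurableT dom (ae_eq_Radon_Nikodym_SigmaFinite dom measurableT).
    by apply: filterS => z h _; rewrite (h I).
move: hle; set k := (\int[pi]_z _)%E.
case: k => [k| |].
- rewrite -!EFinM -!EFinD !lee_fin => hle.
  have -> : k = eta * (eta^-1 * k) by rewrite mulrA divff ?mul1r// gt_eqF.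
  have h : eta^-1 * k <= c0 + eta^-1 * (- eta * c0 + D + E) - c by lra.
  have -> : - eta * c + D + E = eta * (c0 + eta^-1 * (- eta * c0 + D + E) - c).
    by field; rewrite gt_eqF.
  by rewrite ler_pM2l.
- by rewrite gt0_muley ?lte_fin// addey.
- by rewrite leNye.
Qed.

End schrodinger_density.

(** * The regression function *)

(** Truncation to [-1, 1], the range of the labels. *)
Definition clip1 (R : realType) (a : R) : R := Num.max (- 1) (Num.min a 1).

Lemma clip1_id (R : realType) (a : R) : `|a| <= 1 -> clip1 a = a.
Proof.
rewrite ler_norml /clip1 => /andP[h1 h2].
by rewrite (min_idPl h2) (max_idPr h1).
Qed.

Lemma norm_clip1 (R : realType) (a : R) : `|clip1 a| <= 1.
Proof.
rewrite /clip1 ler_norml le_max lexx/= ge_max ge_min lexx orbT andbT.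
by rewrite (le_trans _ ler01)// oppr_le0.
Qed.

Lemma bmeas_clip1 (R : realType) : bmeas (@clip1 R).
Proof.
split; last by exists 1; exact: norm_clip1.
by apply: measurable_maxr => //; exact: measurable_minr.
Qed.

Lemma pkernel_le1 dU (U : measurableType dU) (R : realType) (q : R.-pker U ~> R)
    (y : U) (C : set R) : measurable C -> (q y C <= 1)%E.
Proof.
by move=> mC; rewrite -(prob_kernel (s:=q) y); apply: le_measure; rewrite ?inE.
Qed.

Lemma pkernel_fineK dU (U : measurableType dU) (R : realType) (q : R.-pker U ~> R)
    (y : U) (C : set R) : measurable C -> (fine (q y C))%:E = q y C.
Proof.
move=> mC; rewrite fineK// ge0_fin_numE//.
exact: le_lt_trans (pkernel_le1 q y mC) (ltry _).
Qed.

Section joint_law_integral.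
Context dU (U : measurableType dU) (R : realType).
Variables (nu : probability U R) (q : R.-pker U ~> R) (m : probability (U * R)%type R).
Hypothesis law : joint_law nu q m.

Let k (C : set R) y := fine (q y C).

Lemma bmeas_kernel C : measurable C -> bmeas (fun y => fine (q y C)).
Proof.
move=> mC; split; first by apply: measurableT_comp => //; exact: measurable_kernel.
exists 1 => y; rewrite ger0_norm ?fine_ge0// -lee_fin pkernel_fineK//.
exact: pkernel_le1.
Qed.

Let kge0 C y : 0 <= k C y. Proof. exact: fine_ge0. Qed.

(** Both sides are integrals of [phi] against the measure
    [B |-> m (B `*` C)], which has density [q(., C)] with respect to [nu]. *)
Lemma joint_law_Rintegral (phi : U -> R) (C : set R) : bmeas phi -> measurable C ->
  \int[m]_l (phi l.1 * \1_C l.2) = \int[nu]_y (phi y * fine (q y C)).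
Proof.
move=> bphi mC.
have b1C : bmeas (fun l : U * R => \1_C l.2 : R).
  exact: (bmeas_comp measurable_snd (bmeas_indic R mC)).
have C0 (l : U * R) : 0 <= \1_C l.2 :> R by rewrite indicE.
have bphi1 : bmeas (fun l : U * R => phi l.1) by exact: (bmeas_comp measurable_fst).
pose mC' : {finite_measure set _ -> \bar R} := density m b1C C0.
pose nuC : {finite_measure set _ -> \bar R} := density nu (bmeas_kernel mC) (kge0 C).
have mCE A : measurable A -> mC' A = (\int[m]_(l in A) (\1_C l.2)%:E)%E by [].
have nuCE A : measurable A -> nuC A = (\int[nu]_(l in A) (fine (q l C))%:E)%E by [].
rewrite -(has_density_Rintegral b1C mCE bphi1).
rewrite -(has_density_Rintegral (bmeas_kernel mC) nuCE bphi).
apply/esym/bmeas_Rintegral_pushforward => // B mB.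
have mB' : measurable (fst @^-1` B : set (U * R)).
  by rewrite -[X in measurable X]setTI; exact: measurable_fst.
rewrite nuCE// mCE//.
rewrite (eq_integral (fun y => q y C)); last by move=> y _; rewrite -pkernel_fineK.
rewrite -law// density_Rintegral//.
apply: etrans (measure_Rintegral m (measurableX mB mC)) _.
congr EFin; apply: eq_Rintegral => -[y a] _.
by rewrite !indicE in_setX/= -natrM mulnb.
Qed.

Lemma joint_law_Rintegral1 (phi : U -> R) : bmeas phi ->
  \int[m]_l phi l.1 = \int[nu]_y phi y.
Proof.
move=> bphi.
transitivity (\int[m]_l (phi l.1 * \1_[set: R] l.2)).
  by apply: eq_Rintegral => l _; rewrite indicE in_setT mulr1.
rewrite joint_law_Rintegral//; apply: eq_Rintegral => y _.
by rewrite prob_kernel mulr1.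
Qed.

End joint_law_integral.

Section regression.
Context dT dU (T : measurableType dT) (U : measurableType dU) (R : realType).
Variables (mu : probability T R) (nu : probability U R).
Variables (p : T * U -> R) (bp : bmeas p) (p0 : forall z, 0 <= p z).
Hypothesis p1 : forall x, \int[nu]_y p (x, y) = 1.
Variable pi : probability (T * U)%type R.
Hypothesis piE : forall A, measurable A -> pi A = (\int[(mu \x nu)%E]_(z in A) (p z)%:E)%E.
Variables (q : R.-pker U ~> R) (m : probability (U * R)%type R).
Hypothesis law : joint_law nu q m.
Variable omega : probability ((T * U) * R)%type R.
Hypothesis omega_law : joint_law pi (fun z => q z.2) omega.

Let Q : probability (T * U)%type R := (mu \x nu)%E.
Let Qm : probability (T * (U * R))%type R := (mu \x m)%E.

Let p' (z : T * (U * R)) := p (z.1, z.2.1).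

Let bp' : bmeas p'.
Proof.
apply: (bmeas_comp _ bp); apply: measurable_fun_pair => //.
exact: (measurableT_comp measurable_fst measurable_snd).
Qed.

Let p'0 z : 0 <= p' z. Proof. exact: p0. Qed.

Let w' : {finite_measure set _ -> \bar R} := density Qm bp' p'0.

Let assoc (z : T * (U * R)) := ((z.1, z.2.1), z.2.2).

Let massoc : measurable_fun setT assoc.
Proof.
apply: measurable_fun_pair; last exact: (measurableT_comp measurable_snd measurable_snd).
apply: measurable_fun_pair => //.
exact: (measurableT_comp measurable_fst measurable_snd).
Qed.

Let assoc_mfun : {mfun (T * (U * R))%type >-> ((T * U) * R)%type} :=
  HB.pack assoc (isMeasurableFun.Build _ _ _ _ assoc massoc).

(* The law of (X, Y, A) is [p(x, y) mu(dx) m(dy, da)]. *)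
Let omegaE E : measurable E -> omega E = w' (assoc @^-1` E).
Proof.
move=> mE; pose w2 := pushforward w' assoc_mfun.
have -> : w' (assoc @^-1` E) = w2 E by [].
apply: measure_eq_on_boxes => //.
  by apply: (@le_lt_trans _ _ 1%E); [exact: probability_le1|exact: ltry].
move=> A C mA mC; rewrite omega_law//.
have bk := bmeas_kernel q mC.
have bk2 : bmeas (fun z : T * U => fine (q z.2 C)) by exact: (bmeas_comp measurable_snd bk).
have bA : bmeas (\1_A : T * U -> R) by exact: bmeas_indic.
rewrite (eq_integral (fun z => (fine (q z.2 C))%:E)); last first.
  by move=> z _; rewrite pkernel_fineK.
rewrite density_Rintegral//.
have -> : \int[pi]_x (\1_A x * fine (q x.2 C)) =
    \int[Q]_x ((\1_A x * fine (q x.2 C)) * p x).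
  by apply: has_density_Rintegral => //; exact: bmeasM.
rewrite (bmeas_Rintegral_prod12 mu nu); last by apply: bmeasM => //; exact: bmeasM.
have mAC : measurable (assoc @^-1` (A `*` C)).
  by rewrite -[X in measurable X]setTI; apply: massoc => //; exact: measurableX.
transitivity (\int[Qm]_(z in assoc @^-1` (A `*` C)) (p' z)%:E)%E; last by [].
rewrite density_Rintegral// (bmeas_Rintegral_prod12 mu m); last first.
  by apply: bmeasM => //; exact: bmeas_indic.
congr EFin; apply: eq_Rintegral => x _.
transitivity (\int[nu]_y ((\1_A (x, y) * p (x, y)) * fine (q y C))).
  by apply: eq_Rintegral => y _; ring.
rewrite -(joint_law_Rintegral law)//; last first.
  apply: bmeasM; last exact: bmeas_section1.
  exact: (bmeas_section1 bA).
apply: eq_Rintegral => -[y a] _ /=.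
have -> : \1_(assoc @^-1` (A `*` C)) (x, (y, a)) = \1_A (x, y) * \1_C a :> R.
  rewrite !indicE -natrM mulnb; congr ((nat_of_bool _)%:R).
  apply/idP/andP => [/set_mem[h1 h2]|[/set_mem h1 /set_mem h2]].
    by split; exact/mem_set.
  exact/mem_set.
by rewrite /p'/=; ring.
Qed.

Lemma omega_Rintegral (f : (T * U) * R -> R) : bmeas f ->
  \int[omega]_z f z = \int[mu]_x \int[m]_l (f ((x, l.1), l.2) * p (x, l.1)).
Proof.
move=> bf; rewrite (bmeas_Rintegral_pushforward massoc omegaE bf).
have w'E A : measurable A -> w' A = (\int[Qm]_(z in A) (p' z)%:E)%E by [].
have bfa := bmeas_comp massoc bf.
rewrite (has_density_Rintegral bp' w'E bfa).
by rewrite (bmeas_Rintegral_prod12 mu m (bmeasM bfa bp')).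
Qed.

(** The regression function [E(A | X = x)], written with the law [m] of a
    labelled observation. *)
Definition regression (x : T) : R := \int[m]_l (clip1 l.2 * p (x, l.1)).

Lemma bmeas_regression_kernel :
  bmeas (fun z : T * (U * R) => clip1 z.2.2 * p (z.1, z.2.1)).
Proof.
apply: bmeasM => //; apply: (bmeas_comp _ (@bmeas_clip1 R)).
exact: (measurableT_comp measurable_snd measurable_snd).
Qed.

Lemma bmeas_regression : bmeas regression.
Proof. exact: (bmeas_Rintegral1 mu m bmeas_regression_kernel). Qed.

Lemma regression_density1 x : \int[m]_l p (x, l.1) = 1.
Proof. by rewrite (joint_law_Rintegral1 law (bmeas_section1 bp x)) p1. Qed.

Hypothesis A_bounded : {ae omega, forall z, `|z.2| <= 1}.

Let risk1 (h : T -> R) := (\int[omega]_z ((h z.1.1 - clip1 z.2) ^+ 2)%:E)%E.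

Let m11 : measurable_fun setT (fun z : (T * U) * R => z.1.1).
Proof. exact: (measurableT_comp measurable_fst measurable_fst). Qed.

Let mclip2 : measurable_fun setT (fun z : (T * U) * R => clip1 z.2).
Proof. by apply: (measurableT_comp (bmeas_clip1 R).1). Qed.

Let mrisk (h : T -> R) : measurable_fun setT h ->
  measurable_fun setT (fun z : (T * U) * R => ((h z.1.1 - clip1 z.2) ^+ 2)%:E).
Proof.
move=> mh; apply/measurable_EFinP; apply: measurable_funX.
by apply: measurable_funB => //; exact: (measurableT_comp mh m11).
Qed.

Let riskE (h : T -> R) : measurable_fun setT h ->
  (\int[omega]_z (`|h z.1.1 - z.2| ^+ 2)%:E)%E = risk1 h.
Proof.
move=> mh; apply: ae_eq_integral => //.
- apply/measurable_EFinP; apply: measurable_funX; apply: measurableT_comp => //.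
  by apply: measurable_funB => //; exact: (measurableT_comp mh m11).
- exact: mrisk.
- apply: filterS A_bounded => z hz _.
  by rewrite clip1_id// real_normK// num_real.
Qed.

(** A minimizer of the quadratic risk agrees almost everywhere with the
    regression function: replacing it by the latter on the set where it is at
    most [N] in absolute value changes the risk by a bounded integral. *)
Lemma risk_minimizer_regression (h : T -> R) : measurable_fun setT h ->
  (forall b : T -> R, bmeas b ->
    (\int[omega]_z (`|h z.1.1 - z.2| ^+ 2)%:E <=
     \int[omega]_z (`|(h z.1.1 + b z.1.1) - z.2| ^+ 2)%:E)%E) ->
  (\int[omega]_z (`|h z.1.1 - z.2| ^+ 2)%:E < +oo)%E ->
  {ae mu, forall x, h x = regression x}.
Proof.
move=> mh hmin hfin.
have bh0 := bmeas_regression; have [mh0 _] := bh0.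
have ae_N (N : nat) : {ae mu, forall x, `|h x| <= N%:R -> h x = regression x}.
  pose A := [set x | `|h x| <= N%:R].
  have mA : measurable A.
    have /(_ measurableT [set true]) := @measurable_fun_ler _ _ _ setT (fun x => `|h x|) (cst N%:R) (measurableT_comp (@normr_measurable R setT) mh) (measurable_cst _).
    rewrite setTI => hm; rewrite (_ : A = (fun x => `|h x| <= N%:R) @^-1` [set true]).
      exact: hm.
    by apply/seteqP; split => x /=.
  pose hN x := \1_A x * h x.
  have bhN : bmeas hN.
    split; first by apply: measurable_funM => //; exact: measurable_indic.
    exists N%:R => x; rewrite /hN indicE; case: (boolP (x \in A)) => [/set_mem xA|_].
      by rewrite mul1r.
    by rewrite mul0r normr0.
  have b1A : bmeas (\1_A : T -> R) by exact: bmeas_indic.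
  pose b x := \1_A x * (regression x - hN x).
  have bb : bmeas b by apply: bmeasM => //; exact: bmeasB.
  pose D (z : (T * U) * R) := \1_A z.1.1 *
    ((hN z.1.1 - clip1 z.2) ^+ 2 - (regression z.1.1 - clip1 z.2) ^+ 2).
  have bc2 : bmeas (fun z : (T * U) * R => clip1 z.2) by exact: (bmeas_comp measurable_snd (bmeas_clip1 R)).
  have bD : bmeas D.
    apply: bmeasM; first exact: (bmeas_comp m11 b1A).
    by apply: bmeasB; apply: bmeasX; apply: bmeasB => //; [exact: (bmeas_comp m11 bhN)|exact: (bmeas_comp m11 bh0)].
  have Dle0 : \int[omega]_z D z <= 0.
    have mhb : measurable_fun setT (fun x => h x + b x) by apply: measurable_funD => //; case: bb.
    have := hmin _ bb.
    rewrite (riskE mh) (riskE mhb).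
    have i1 : omega.-integrable setT (fun z => ((h z.1.1 - clip1 z.2) ^+ 2)%:E).
      apply/integrableP; split; first exact: mrisk.
      move: hfin; rewrite (riskE mh); apply: le_lt_trans; rewrite le_eqVlt; apply/orP; left; apply/eqP.
      by apply: eq_integral => z _; rewrite gee0_abs// lee_fin sqr_ge0.
    have -> : risk1 (fun x => h x + b x) = (risk1 h - \int[omega]_z (D z)%:E)%E.
      rewrite -integralB//; last exact: bmeas_integrable.
      apply: eq_integral => z _; rewrite -EFinB; congr EFin.
      rewrite /D /b /hN indicE; case: (_ \in A); rewrite ?mul0r ?addr0 ?subr0// !mul1r.
      by ring.
    have rfin : risk1 h \is a fin_num by exact: integrable_fin_num.
    rewrite bmeas_RintegralE// -(fineK rfin) -EFinB lee_fin; lra.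
  have DE : \int[omega]_z D z = \int[mu]_x (\1_A x * (hN x - regression x) ^+ 2).
    rewrite (omega_Rintegral bD); apply: eq_Rintegral => x _.
    have bpx : bmeas (fun l : U * R => p (x, l.1)) by exact: (bmeas_section1 bp' x).
    have bcp : bmeas (fun l : U * R => clip1 l.2 * p (x, l.1)) by exact: (bmeas_section1 bmeas_regression_kernel x).
    transitivity (\int[m]_l ((\1_A x * (hN x ^+ 2 - regression x ^+ 2)) * p (x, l.1) -
        (\1_A x * (2 * (hN x - regression x))) * (clip1 l.2 * p (x, l.1)))).
      by apply: eq_Rintegral => l _; rewrite /D/=; ring.
    rewrite bmeas_RintegralB; [|by apply: bmeasM => //; exact: bmeas_cst..].
    rewrite !bmeas_RintegralZl// regression_density1 -/(regression x).
    by ring.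
  have bG : bmeas (fun x => \1_A x * (hN x - regression x) ^+ 2).
    by apply: bmeasM => //; apply: bmeasX; exact: bmeasB.
  have G0 x : 0 <= \1_A x * (hN x - regression x) ^+ 2 by rewrite mulr_ge0 ?sqr_ge0 ?indicE.
  have : ae_eq mu setT (fun x => (\1_A x * (hN x - regression x) ^+ 2)%:E) (cst 0%E).
    apply/ae_eq_integral_abs => //; first by apply/measurable_EFinP; case: bG.
    rewrite (eq_integral (fun x => (\1_A x * (hN x - regression x) ^+ 2)%:E)); last first.
      by move=> x _; rewrite gee0_abs// lee_fin.
    rewrite bmeas_RintegralE//; congr EFin; apply/eqP; rewrite eq_le -DE Dle0/= DE.
    exact: Rintegral_ge0.
  apply: filterS => x /(_ I)[+] hx.
  rewrite /hN indicE mem_set//= !mul1r => /eqP; rewrite sqrf_eq0 subr_eq0 => /eqP //.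
have : {ae mu, forall x, forall N : nat, `|h x| <= N%:R -> h x = regression x}.
  exact/ae_foralln.
apply: filterS => x hx; apply: (hx (Num.truncn `|h x|).+1).
exact/ltW/truncnS_gt.
Qed.

End regression.

(** * Second moments of centred empirical averages *)

Lemma measurable_preimage dO (Omega : measurableType dO) dS (S : measurableType dS)
    (Z : {mfun Omega >-> S}) (A : set S) :
  measurable A -> measurable (Z @^-1` A).
Proof. by move=> mA; exact: measurable_funPTI. Qed.

Lemma Rintegral_distribution dO (Omega : measurableType dO) (R : realType)
    (P : probability Omega R) dS (S : measurableType dS)
    (Z : {mfun Omega >-> S}) (f : S -> R) : bmeas f ->
  \int[distribution P Z]_s f s = \int[P]_w f (Z w).
Proof. by move=> bf; exact: bmeas_Rintegral_pushforward. Qed.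

Section independence.
Context dO (Omega : measurableType dO) (R : realType) (P : probability Omega R).
Context dS dV (S : measurableType dS) (V : measurableType dV).

(** The joint map [w |-> (Z w, W w)] as a measurable function. *)
Definition mpair (Z : {mfun Omega >-> S}) (W : {mfun Omega >-> V}) :
    {mfun Omega >-> (S * V)%type} :=
  HB.pack (fun w => (Z w, W w))
    (isMeasurableFun.Build _ _ _ _ (fun w => (Z w, W w))
      (measurable_fun_pair (measurable_funPT Z) (measurable_funPT W))).

(** [m] stands for the law of [W]. *)
Lemma indep_Rintegral (Z : {mfun Omega >-> S}) (W : {mfun Omega >-> V})
    (m : probability V R) (f : S * V -> R) :
  (forall A B, measurable A -> measurable B ->
    P (Z @^-1` A `&` W @^-1` B) = (P (Z @^-1` A) * m B)%E) ->
  bmeas f ->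
  \int[P]_w f (Z w, W w) = \int[distribution P Z]_s \int[m]_v f (s, v).
Proof.
move=> ZW bf; rewrite -(bmeas_Rintegral_prod12 (distribution P Z) m bf).
rewrite -(Rintegral_distribution P (mpair Z W) bf); congr fine.
apply: eq_measure_integral => E mE _.
apply: measure_eq_on_boxes => //.
  apply: (@le_lt_trans _ _ 1%E); last exact: ltry.
  exact: (@probability_le1 _ _ _ (distribution P (mpair Z W))).
move=> A B mA mB; rewrite [RHS]product_measure1E//.
by rewrite /= -ZW.
Qed.

End independence.

Section variance.
Context dO (Omega : measurableType dO) (R : realType) (P : probability Omega R).
Context dS dV (S : measurableType dS) (V : measurableType dV) (n : nat).
Variables (Z : {mfun Omega >-> S}) (W : 'I_n -> {mfun Omega >-> V}).
Variable m : probability V R.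
Hypothesis indep : forall j k, j != k -> forall A B C,
  measurable A -> measurable B -> measurable C ->
  P (Z @^-1` A `&` W j @^-1` B `&` W k @^-1` C) =
  (P (Z @^-1` A `&` W j @^-1` B) * m C)%E.

(* Independence extends from rectangles to events of the pair [(Z, W j)]. *)
Let indep_pair j k : j != k -> forall E C, measurable E -> measurable C ->
  P (mpair Z (W j) @^-1` E `&` W k @^-1` C) =
  (P (mpair Z (W j) @^-1` E) * m C)%E.
Proof.
move=> jk E C mE mC.
have mWC := measurable_preimage (W k) mC.
have mC0 : 0 <= fine (m C) by exact: fine_ge0.
pose m1 := pushforward (mrestr P mWC) (mpair Z (W j)).
pose m2 := mscale (NngNum mC0) (distribution P (mpair Z (W j))).
have m2E X : m2 X = (P (mpair Z (W j) @^-1` X) * m C)%E.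
  rewrite /m2 /mscale -[X in (_ * X)%E]/(P (mpair Z (W j) @^-1` _)) muleC.
  by congr (_ * _)%E; rewrite -[RHS]fineK// fin_num_measure.
have h : m1 E = m2 E.
  apply: measure_eq_on_boxes => //.
    rewrite /m1 /pushforward/= /mrestr; apply: (@le_lt_trans _ _ 1%E); last exact: ltry.
    apply: probability_le1; apply: measurableI => //.
    exact: (measurable_preimage (mpair Z (W j))).
  move=> A B mA mB; apply: etrans (esym (m2E _)); exact: indep.
exact: etrans h (m2E _).
Qed.

Variables (phi : S * V -> R) (M : R).
Hypotheses (bphi : bmeas phi) (phiM : forall z, `|phi z| <= M).
Hypothesis phi0 : forall s, \int[m]_v phi (s, v) = 0.

Let bphiW j : bmeas (fun w => phi (Z w, W j w)).
Proof. exact: (bmeas_comp (measurable_funPT (mpair Z (W j)))). Qed.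

Let cross j k : j != k ->
  \int[P]_w (phi (Z w, W j w) * phi (Z w, W k w)) = 0.
Proof.
move=> jk.
pose f (z : (S * V) * V) := phi z.1 * phi (z.1.1, z.2).
have bf : bmeas f.
  apply: bmeasM; first exact: (bmeas_comp measurable_fst).
  apply: (bmeas_comp _ bphi); apply: measurable_fun_pair => //.
  exact: (measurableT_comp measurable_fst measurable_fst).
rewrite -[LHS]/(\int[P]_w f (mpair Z (W j) w, W k w)).
rewrite (indep_Rintegral (indep_pair jk) bf).
rewrite -[RHS](Rintegral_probability_cst (distribution P (mpair Z (W j)))).
apply: eq_Rintegral => -[s v] _; rewrite /f/= bmeas_RintegralZl ?phi0 ?mulr0//.
exact: bmeas_section1.
Qed.

(** Centred terms that are conditionally independent given [Z] are orthogonal,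
    so only the [n] diagonal terms of the square survive. *)
Lemma variance_average :
  \int[P]_w ((n%:R^-1 * \sum_(j < n) phi (Z w, W j w)) ^+ 2) <= M ^+ 2 / n%:R.
Proof.
have M0 : 0 <= M by exact: le_trans (phiM (point, point)).
have -> : \int[P]_w ((n%:R^-1 * \sum_(j < n) phi (Z w, W j w)) ^+ 2) =
   n%:R^-1 ^+ 2 * \sum_(j < n) \sum_(k < n) \int[P]_w (phi (Z w, W j w) * phi (Z w, W k w)).
  rewrite (eq_bigr (fun j => \int[P]_w
      (\sum_(k < n) phi (Z w, W j w) * phi (Z w, W k w)))); last first.
    by move=> j _; rewrite bmeas_Rintegral_sum// => k; exact: bmeasM.
  rewrite -bmeas_Rintegral_sum; last first.
    by move=> j; apply: bmeas_sum => k; exact: bmeasM.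
  rewrite -bmeas_RintegralZl; last first.
    by apply: bmeas_sum => j; apply: bmeas_sum => k; exact: bmeasM.
  apply: eq_Rintegral => w _; rewrite exprMn; congr (_ * _).
  by rewrite expr2 mulr_suml; apply: eq_bigr => j _; rewrite mulr_sumr.
apply: (@le_trans _ _ (n%:R^-1 ^+ 2 * \sum_(j < n) M ^+ 2)).
  rewrite ler_wpM2l ?exprn_ge0 ?invr_ge0//; apply: ler_sum => j _.
  rewrite (bigD1 j)//= big1 ?addr0; last by move=> k kj; rewrite cross// eq_sym kj.
  apply: le_Rintegral_cst; first exact: bmeasM.
  move=> w; rewrite -expr2 -[leLHS]real_normK ?num_real//.
  by rewrite ler_sqr ?nnegrE// phiM.
rewrite sumr_const card_ord -[X in _ * X]mulr_natl.
have [->|n0] := eqVneq (n%:R : R) 0; first by rewrite invr0 !(mul0r, mulr0).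
by rewrite mulrA expr2 -(mulrA n%:R^-1) mulVf// mulr1 mulrC.
Qed.

End variance.

(** * Empirical potentials *)

Section empirical_integral.
Context d (T : measurableType d) (R : realType) (n : nat) (x : 'I_n -> T).

Lemma ge0_integral_empirical (f : T -> \bar R) : measurable_fun setT f ->
  (forall t, 0 <= f t)%E ->
  (\int[empirical R x]_t f t = (n%:R^-1)%:E * \sum_(i < n) f (x i))%E.
Proof.
move=> mf f0; pose x' k := oapp x point (insub k).
have n0 : 0 <= (n%:R^-1 : R) by rewrite invr_ge0.
pose m := mscale (NngNum n0) (msum (fun k => dirac (x' k) : {measure set T -> \bar R}) n).
rewrite (eq_measure_integral m); last first.
  move=> A mA _; rewrite /m /mscale/= /empirical /msum; congr (_ * _)%E.
  by apply: eq_bigr => i _; rewrite /x' valK.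
rewrite /m ge0_integral_mscale//; congr (_ * _)%E.
rewrite ge0_integral_measure_sum//; apply: eq_bigr => i _.
by rewrite integral_dirac// diracT mul1e /x' valK.
Qed.

Lemma Rintegral_empirical (f : T -> R) : measurable_fun setT f ->
  \int[empirical R x]_t f t = n%:R^-1 * \sum_(i < n) f (x i).
Proof.
move=> mf; have mf' : measurable_fun setT (EFin \o f) by exact/measurable_EFinP.
rewrite /Rintegral integralE !ge0_integral_empirical//; last 2 first.
- exact: measurable_funeneg.
- exact: measurable_funepos.
have E1 : (\sum_(i < n) (EFin \o f)^\+ (x i) = (\sum_(i < n) Num.max (f (x i)) 0)%:E)%E.
  by rewrite -sumEFin; apply: eq_bigr => i _; rewrite funeposE/= -EFin_max.
have E2 : (\sum_(i < n) (EFin \o f)^\- (x i) = (\sum_(i < n) Num.max (- f (x i)) 0)%:E)%E.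
  by rewrite -sumEFin; apply: eq_bigr => i _; rewrite funenegE/= -EFin_max.
rewrite [X in (_ * X - _)%E](_ : _ = (\sum_(i < n) Num.max (f (x i)) 0)%:E); last exact: E1.
rewrite [X in (_ - _ * X)%E](_ : _ = (\sum_(i < n) Num.max (- f (x i)) 0)%:E); last exact: E2.
rewrite -!EFinM -EFinB/= -mulrBr -sumrB; congr (_ * _).
apply: eq_bigr => i _; rewrite !maxEle; case: (leP (f (x i)) 0) => h.
  by case: ifPn => [|_]; lra.
by case: ifPn => [_|]; lra.
Qed.

End empirical_integral.

Lemma Rintegral_empirical_prod d1 d2 (T : measurableType d1) (U : measurableType d2)
    (R : realType) (n : nat) (x : 'I_n -> T) (y : 'I_n -> U) (f : T * U -> R) :
  measurable_fun setT f -> (forall z, 0 <= f z) ->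
  \int[(empirical R x \x empirical R y)%E]_z f z =
  n%:R^-1 * \sum_(i < n) (n%:R^-1 * \sum_(j < n) f (x i, y j)).
Proof.
move=> mf f0.
have mf' : measurable_fun setT (EFin \o f) by exact/measurable_EFinP.
have f0' z : (0 <= (EFin \o f) z)%E by rewrite lee_fin.
have E := @fubini_tonelli1 _ _ _ _ R (empirical R x) (empirical R y) _ mf' f0'.
rewrite /Rintegral [X in fine X]E ge0_integral_empirical; last 2 first.
- exact: measurable_fun_fubini_tonelli_F.
- by move=> t; apply: integral_ge0 => u _; exact: f0'.
rewrite (eq_bigr (fun i => (n%:R^-1 * \sum_(j < n) f (x i, y j))%:E)).
  by rewrite sumEFin -EFinM.
move=> i _; rewrite /fubini_F ge0_integral_empirical//=.
  by rewrite sumEFin EFinM.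
  exact: (measurableT_comp mf' (pair1_measurable (x i))).
by move=> t; exact: f0'.
Qed.

Lemma bmeas_Lfun_oo d (T : measurableType d) (R : realType)
    (mu : {measure set T -> \bar R}) (f : T -> R) : bmeas f -> f \in Lfun mu +oo%E.
Proof.
move=> [mf [M fM]]; rewrite inE; apply/andP; split; rewrite inE//=.
rewrite /finite_norm unlock /Lnorm; case: ifPn => _; last exact: ltry.
apply: (@le_lt_trans _ _ M%:E); last exact: ltry.
by apply: ess_sup_ler => t; rewrite lee_fin.
Qed.

Section dual.
Context (R : realType) (eta : R) (d n : nat).
Hypotheses (eta0 : 0 < eta) (n0 : (0 < n)%N).
Local Notation V := (d.-tuple R).
Variables (x y : 'I_n -> V).
Implicit Types f g : V -> R.

Let eta_neq0 : eta != 0. Proof. by rewrite gt_eqF. Qed.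
Let nR0 : 0 < n%:R :> R. Proof. by rewrite ltr0n. Qed.

Lemma gibbs_gt0 f g u v : 0 < gibbs eta f g u v.
Proof. exact: expR_gt0. Qed.

Lemma gibbsE f g u v :
  gibbs eta f g u v = expR (eta * f u) * expR (- eta * sqdist u v + eta * g v).
Proof. by rewrite /gibbs -expRD; congr expR; ring. Qed.

Lemma gibbsE2 f g u v :
  gibbs eta f g u v = expR (eta * g v) * expR (- eta * sqdist u v + eta * f u).
Proof. by rewrite /gibbs -expRD; congr expR; ring. Qed.

Lemma measurable_gibbs f g : measurable_fun setT f -> measurable_fun setT g ->
  measurable_fun setT (fun z : V * V => gibbs eta f g z.1 z.2).
Proof.
move=> mf mg; apply: measurableT_comp => //; apply: measurable_funM => //.
apply: measurable_funB; last exact: (measurableT_comp mg measurable_snd).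
apply: measurable_funB; last exact: (measurableT_comp mf measurable_fst).
exact: measurable_sqdist.
Qed.

Lemma dual_functionalE f g : measurable_fun setT f -> measurable_fun setT g ->
  dual_functional eta x y f g =
  n%:R^-1 * \sum_(i < n) f (x i) + n%:R^-1 * \sum_(j < n) g (y j) -
  eta^-1 * (n%:R^-1 * \sum_(i < n) (n%:R^-1 * \sum_(j < n) gibbs eta f g (x i) (y j)))
  + eta^-1.
Proof.
move=> mf mg; rewrite /dual_functional !Rintegral_empirical// Rintegral_empirical_prod//.
  exact: measurable_gibbs.
by move=> z; exact/ltW/gibbs_gt0.
Qed.

(** Equality case in [eta t <= e^(eta t) - 1], summed over the sample. *)
Lemma partial_maximum_unique (F0 F : 'I_n -> R) :
  n%:R^-1 * \sum_(i < n) F i - eta^-1 * (n%:R^-1 * \sum_(i < n) (1 : R)) <=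
  n%:R^-1 * \sum_(i < n) F0 i -
    eta^-1 * (n%:R^-1 * \sum_(i < n) expR (eta * (F0 i - F i))) ->
  forall i, F i = F0 i.
Proof.
move=> h.
pose t i := expR (eta * (F0 i - F i)) - 1 - eta * (F0 i - F i).
have t0 i : 0 <= t i by have := expR_ge1Dx (eta * (F0 i - F i)); rewrite /t; lra.
have : \sum_(i < n) t i <= 0.
  have -> : \sum_(i < n) t i = eta * n%:R *
     (eta^-1 * (n%:R^-1 * \sum_(i < n) expR (eta * (F0 i - F i))) -
      eta^-1 * (n%:R^-1 * \sum_(i < n) (1 : R)) -
      (n%:R^-1 * \sum_(i < n) F0 i - n%:R^-1 * \sum_(i < n) F i)).
    rewrite !sumrB -mulr_sumr sumrB; field; rewrite eta_neq0/=.
    by rewrite gt_eqF.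
  rewrite mulr_ge0_le0 ?mulr_ge0 ?(ltW eta0)//; lra.
move=> st i; have ti : t i = 0.
  apply/eqP; rewrite eq_le t0 andbT; apply: le_trans st.
  by rewrite (bigD1 i)//= lerDl sumr_ge0.
apply/eqP; rewrite eq_sym -subr_eq0; apply: contraTT isT => hne.
have : eta * (F0 i - F i) != 0 by rewrite mulf_neq0.
by move=> /expR_gt1Dx; move: ti; rewrite /t; lra.
Qed.

(* Truncation beyond the sample values keeps the dual functional and makes a
   potential bounded, hence an admissible competitor. *)
Let clip M f : V -> R := fun u => Num.max (- M) (Num.min (f u) M).

Let clip_id M f u : `|f u| <= M -> clip M f u = f u.
Proof.
rewrite ler_norml /clip => /andP[h1 h2].
by rewrite (min_idPl h2) (max_idPr h1).
Qed.

Let bclip M f : 0 <= M -> measurable_fun setT f -> bmeas (clip M f).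
Proof.
move=> M0 mf; split.
  by apply: measurable_maxr => //; exact: measurable_minr.
exists M => u; rewrite /clip ler_norml le_max lexx/= ge_max ge_min lexx orbT andbT.
by rewrite (le_trans _ M0)// oppr_le0.
Qed.

Let le_sum_norm (F : 'I_n -> R) i : `|F i| <= \sum_(k < n) `|F k|.
Proof. by rewrite (bigD1 i)//= lerDl sumr_ge0. Qed.

Let measurable_potential (z : 'I_n -> V) (h : V -> V -> R) (c : 'I_n -> R) f :
  (forall j, measurable_fun setT (fun u => h u (z j))) ->
  (forall u, expR (- eta * f u) = n%:R^-1 * \sum_(j < n) expR (- eta * h u (z j) + c j)) ->
  measurable_fun setT f.
Proof.
move=> mh fE.
have -> : f = fun u => - eta^-1 * ln (n%:R^-1 * \sum_(j < n) expR (- eta * h u (z j) + c j)).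
  by apply/funext => u; rewrite -fE expRK; field.
apply: measurable_funM => //; apply: measurableT_comp => //.
apply: measurable_funM => //; apply: measurable_sum => j.
apply: measurableT_comp => //; apply: measurable_funD => //.
exact: measurable_funM.
Qed.

(** The extended potentials satisfy the Schrodinger system of the empirical
    measures.  Replacing [f0] (or [g0]) by its extension cannot decrease the
    dual functional, hence by maximality they agree at the sample points. *)
Lemma empirical_potentials_marginals f g : empirical_potentials eta x y f g ->
  (forall u, n%:R^-1 * \sum_(j < n) gibbs eta f g u (y j) = 1) /\
  (forall v, n%:R^-1 * \sum_(i < n) gibbs eta f g (x i) v = 1).
Proof.
move=> [f0 [g0 [[Lf0 Lg0 _ opt] fE gE]]].
have mf0 : measurable_fun setT f0 by move: Lf0; rewrite inE => /andP[]; rewrite inE.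
have mg0 : measurable_fun setT g0 by move: Lg0; rewrite inE => /andP[]; rewrite inE.
have mf : measurable_fun setT f.
  apply: (measurable_potential (z := y) (h := fun u v => sqdist u v)) fE => j.
  exact: (measurableT_comp (@measurable_sqdist R d) (pair2_measurable (y j))).
have mg : measurable_fun setT g.
  apply: (measurable_potential (z := x) (h := fun u v => sqdist v u)) gE => j.
  exact: (measurableT_comp (@measurable_sqdist R d) (pair1_measurable (x j))).
have ff0 : forall i, f (x i) = f0 (x i).
  pose M := \sum_(k < n) `|f (x k)|.
  have M0 : 0 <= M by rewrite sumr_ge0.
  have cE i : clip M f (x i) = f (x i) by apply: clip_id; exact: (le_sum_norm (f \o x)).
  have bc := bclip M0 mf.
  have := opt (clip M f) g0 (bmeas_Lfun_oo _ bc) Lg0.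
  rewrite !dual_functionalE//; last by case: bc.
  have E1 i : n%:R^-1 * \sum_(j < n) gibbs eta (clip M f) g0 (x i) (y j) = 1.
    under eq_bigr do rewrite gibbsE.
    by rewrite -mulr_sumr mulrCA -fE cE -expRD mulNr subrr expR0.
  have E2 i : n%:R^-1 * \sum_(j < n) gibbs eta f0 g0 (x i) (y j) =
      expR (eta * (f0 (x i) - f (x i))).
    under eq_bigr do rewrite gibbsE.
    by rewrite -mulr_sumr mulrCA -fE -expRD mulNr mulrBr.
  under [X in _ <= _ - _ * (_ * X) + _]eq_bigr do rewrite E2.
  under [X in _ * X + _ - _ + _ <= _]eq_bigr do rewrite cE.
  under [X in _ - _ * (_ * X) + _ <= _]eq_bigr do rewrite E1.
  by move=> h; apply: (partial_maximum_unique (F0 := f0 \o x) (F := f \o x)); rewrite /=; lra.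
have gg0 : forall i, g (y i) = g0 (y i).
  pose M := \sum_(k < n) `|g (y k)|.
  have M0 : 0 <= M by rewrite sumr_ge0.
  have cE i : clip M g (y i) = g (y i) by apply: clip_id; exact: (le_sum_norm (g \o y)).
  have bc := bclip M0 mg.
  have := opt f0 (clip M g) Lf0 (bmeas_Lfun_oo _ bc).
  rewrite !dual_functionalE//; last by case: bc.
  have E1 j : n%:R^-1 * \sum_(i < n) gibbs eta f0 (clip M g) (x i) (y j) = 1.
    under eq_bigr do rewrite gibbsE2.
    by rewrite -mulr_sumr mulrCA -gE cE -expRD mulNr subrr expR0.
  have E2 j : n%:R^-1 * \sum_(i < n) gibbs eta f0 g0 (x i) (y j) =
      expR (eta * (g0 (y j) - g (y j))).
    under eq_bigr do rewrite gibbsE2.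
    by rewrite -mulr_sumr mulrCA -gE -expRD mulNr mulrBr.
  have ex f' g' : \sum_(i < n) (n%:R^-1 * \sum_(j < n) gibbs eta f' g' (x i) (y j)) =
      \sum_(j < n) (n%:R^-1 * \sum_(i < n) gibbs eta f' g' (x i) (y j)).
    by rewrite -!mulr_sumr exchange_big.
  rewrite (ex f0 g0) (ex f0 (clip M g)).
  under [X in _ <= _ - _ * (_ * X) + _]eq_bigr do rewrite E2.
  under [X in _ + _ * X - _ + _ <= _]eq_bigr do rewrite cE.
  under [X in _ - _ * (_ * X) + _ <= _]eq_bigr do rewrite E1.
  by move=> h; apply: (partial_maximum_unique (F0 := g0 \o y) (F := g \o y)); rewrite /=; lra.
split=> [u|v].
  under eq_bigr do rewrite gibbsE gg0.
  by rewrite -mulr_sumr mulrCA -fE -expRD mulNr subrr expR0.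
under eq_bigr do rewrite gibbsE2 ff0.
by rewrite -mulr_sumr mulrCA -gE -expRD mulNr subrr expR0.
Qed.

End dual.

(** * Stability of the empirical Schrodinger system *)

Section finite_averages.
Context (R : realType) (n : nat).
Hypothesis n0 : (0 < n)%N.

Let nR0 : 0 < n%:R :> R. Proof. by rewrite ltr0n. Qed.

Local Notation avg F := (n%:R^-1 * \sum_(j < n) F j).

Lemma avg_cst (c : R) : avg (fun _ => c) = c.
Proof. by rewrite sumr_const card_ord -[X in _ * X]mulr_natl mulKf// gt_eqF. Qed.

Lemma avg_le (F G : 'I_n -> R) : (forall j, F j <= G j) -> avg F <= avg G.
Proof. by move=> FG; rewrite ler_wpM2l ?invr_ge0//; apply: ler_sum => j _; exact: FG. Qed.

Lemma avgD (F G : 'I_n -> R) : avg (fun j => F j + G j) = avg F + avg G.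
Proof. by rewrite big_split mulrDr. Qed.

Lemma avgB (F G : 'I_n -> R) : avg (fun j => F j - G j) = avg F - avg G.
Proof. by rewrite sumrB mulrBr. Qed.

Lemma avgZ (c : R) (F : 'I_n -> R) : avg (fun j => c * F j) = c * avg F.
Proof. by rewrite -mulr_sumr mulrCA. Qed.

Lemma sqr_avg_le (F : 'I_n -> R) : (avg F) ^+ 2 <= avg (fun j => F j ^+ 2).
Proof.
set m := avg F.
have : 0 <= avg (fun j => (F j - m) ^+ 2).
  by rewrite mulr_ge0 ?invr_ge0//; apply: sumr_ge0 => j _; exact: sqr_ge0.
have -> : avg (fun j => (F j - m) ^+ 2) =
    avg (fun j => F j ^+ 2) + (avg (fun j => - (2 * m) * F j) + avg (fun=> m ^+ 2)).
  by rewrite -!avgD; congr (_ * _); apply: eq_bigr => j _; ring.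
by rewrite avgZ avg_cst -/m; lra.
Qed.

Lemma avg_zero_norm_le (v : 'I_n -> R) (D : R) : avg v = 0 ->
  (forall j k, v j - v k <= D) -> forall j, `|v j| <= D.
Proof.
move=> v0 vD j.
have vjE : v j = avg (fun k => v j - v k) by rewrite avgB avg_cst v0 subr0.
have vjE' : - v j = avg (fun k => v k - v j) by rewrite avgB avg_cst v0 sub0r.
rewrite ler_norml; apply/andP; split.
  by rewrite lerNl vjE' -[leRHS]avg_cst; apply: avg_le.
by rewrite [leLHS]vjE -[leRHS]avg_cst; apply: avg_le.
Qed.

(** Strong monotonicity of [s |-> P e^s], with the smaller of the two values
    [P] and [P e^s] as a modulus. *)
Lemma expR_monotone_gap (P PN s k : R) : 0 < k -> k <= P -> k <= PN ->
  PN = P * expR s -> k * s ^+ 2 <= (PN - P) * s.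
Proof.
move=> k0 kP kPN PNE.
have [s0|s0] := leP 0 s.
  apply: (@le_trans _ _ (P * s ^+ 2)); first by rewrite ler_wpM2r ?sqr_ge0.
  have -> : PN - P = P * (expR s - 1) by rewrite PNE; ring.
  rewrite -mulrA ler_wpM2l ?(le_trans (ltW k0))// expr2 ler_wpM2r//.
  by have := expR_ge1Dx s; lra.
apply: (@le_trans _ _ (PN * s ^+ 2)); first by rewrite ler_wpM2r ?sqr_ge0.
have PE : P = PN * expR (- s) by rewrite PNE expRN mulfK// gt_eqF// expR_gt0.
have -> : (PN - P) * s = PN * ((expR (- s) - 1) * (- s)) by rewrite {1}PE; ring.
rewrite ler_wpM2l ?(le_trans (ltW k0))// expr2 -[s * s]mulrNN ler_wpM2r ?oppr_ge0 ?(ltW s0)//.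
by have := expR_ge1Dx (- s); lra.
Qed.

(** Strong concavity of the dual: log-scalings [u], [v] carrying the matrix [P]
    to a matrix [PN] with unit marginals are controlled by the marginal defects
    of [P]; the normalization [avg v = 0] removes the cross term. *)
Lemma scaling_stability (P PN : 'I_n -> 'I_n -> R) (u v : 'I_n -> R) (k : R) :
  0 < k -> (forall i j, k <= P i j) -> (forall i j, k <= PN i j) ->
  (forall i j, PN i j = P i j * expR (u i + v j)) ->
  (forall i, avg (fun j => PN i j) = 1) -> (forall j, avg (fun i => PN i j) = 1) ->
  avg v = 0 ->
  avg (fun i => u i ^+ 2) + avg (fun j => v j ^+ 2) <=
  k^-1 ^+ 2 * (avg (fun i => (1 - avg (fun j => P i j)) ^+ 2) +
               avg (fun j => (1 - avg (fun i => P i j)) ^+ 2)).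
Proof.
move=> k0 kP kPN PNE row col v0.
set Gf := fun i => 1 - avg (fun j => P i j).
set Gg := fun j => 1 - avg (fun i => P i j).
have ex (F : 'I_n -> 'I_n -> R) : avg (fun i => avg (fun j => F i j)) = avg (fun j => avg (fun i => F i j)).
  by rewrite -!mulr_sumr exchange_big.
pose U := avg (fun i => u i ^+ 2); pose W := avg (fun j => v j ^+ 2).
have lhsE : avg (fun i => avg (fun j => k * (u i + v j) ^+ 2)) = k * (U + W).
  transitivity (avg (fun i => k * u i ^+ 2 + (k * W))).
    congr (_ * _); apply: eq_bigr => i _.
    transitivity (avg (fun j => k * u i ^+ 2 + ((2 * k * u i) * v j + k * v j ^+ 2))).
      by congr (_ * _); apply: eq_bigr => j _; ring.
    by rewrite !avgD !avgZ v0 avg_cst mulr0 add0r.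
  by rewrite avgD avgZ avg_cst mulrDr.
have rhsE : avg (fun i => avg (fun j => (PN i j - P i j) * (u i + v j))) =
    avg (fun i => u i * Gf i) + avg (fun j => v j * Gg j).
  transitivity (avg (fun i => avg (fun j => u i * (PN i j - P i j))) +
                avg (fun i => avg (fun j => v j * (PN i j - P i j)))).
    rewrite -avgD; congr (_ * _); apply: eq_bigr => i _; rewrite -avgD.
    by congr (_ * _); apply: eq_bigr => j _; ring.
  congr (_ + _).
    by congr (_ * _); apply: eq_bigr => i _; rewrite avgZ avgB row.
  rewrite ex; congr (_ * _); apply: eq_bigr => j _.
  by rewrite avgZ avgB col.
have main : k * (U + W) <= avg (fun i => u i * Gf i) + avg (fun j => v j * Gg j).
  rewrite -lhsE -rhsE; apply: avg_le => i; apply: avg_le => j.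
  exact: expR_monotone_gap.
have young (a b : R) : a * b <= k / 2 * a ^+ 2 + (2 * k)^-1 * b ^+ 2.
  have -> : k / 2 * a ^+ 2 + (2 * k)^-1 * b ^+ 2 = a * b + (k * a - b) ^+ 2 / (2 * k).
    by field; rewrite gt_eqF.
  by rewrite lerDl divr_ge0 ?sqr_ge0// mulr_ge0// ltW.
have y1 : avg (fun i => u i * Gf i) <= k / 2 * U + (2 * k)^-1 * avg (fun i => Gf i ^+ 2).
  by rewrite -!avgZ -avgD; apply: avg_le => i; exact: young.
have y2 : avg (fun i => v i * Gg i) <= k / 2 * W + (2 * k)^-1 * avg (fun i => Gg i ^+ 2).
  by rewrite -!avgZ -avgD; apply: avg_le => i; exact: young.
rewrite -/U -/W.
move: main y1 y2; set a1 := avg (fun i => u i * Gf i); set a2 := avg (fun i => v i * Gg i).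
set g1 := avg (fun i => Gf i ^+ 2); set g2 := avg (fun i => Gg i ^+ 2) => main y1 y2.
have h : k / 2 * (U + W) <= (2 * k)^-1 * (g1 + g2) by lra.
have k2 : 0 < k / 2 by rewrite divr_gt0.
rewrite -(ler_pM2l k2); apply: (le_trans h).
by rewrite le_eqVlt; apply/orP; left; apply/eqP; field; rewrite gt_eqF.
Qed.

Lemma expR_sub1_sqr_le (v D : R) : `|v| <= D -> (expR v - 1) ^+ 2 <= expR D ^+ 2 * v ^+ 2.
Proof.
move=> vD; have D0 : 0 <= D by exact: le_trans vD.
have E1 : 1 <= expR D by rewrite -expR0 ler_expR.
have E0 : 0 < expR D by exact: expR_gt0.
rewrite -exprMn -[leLHS]real_normK ?num_real// -[leRHS]real_normK ?num_real//.
rewrite ler_sqr ?nnegrE// normrM (gtr0_norm E0).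
have [v0|v0] := leP 0 v.
  rewrite (ger0_norm v0) ger0_norm ?subr_ge0 -?expR0 ?ler_expR// expR0.
  have h1 := expR_ge1Dx (- v); have ev := expR_gt0 v.
  have h2 : expR v * expR (- v) = 1 by rewrite -expRD subrr expR0.
  apply: (@le_trans _ _ (expR v * v)).
    have : expR v * (1 - v) <= expR v * expR (- v) by rewrite ler_wpM2l ?(ltW ev)//; lra.
    by rewrite h2; lra.
  by rewrite ler_wpM2r// ler_expR; exact: le_trans (ler_norm _) vD.
rewrite (ltr0_norm v0) ler0_norm; last by rewrite subr_le0 -expR0 ler_expR ltW.
have h1 := expR_ge1Dx v.
by apply: (@le_trans _ _ (- v)); [lra|rewrite ler_peMl// oppr_ge0 ltW].
Qed.

(** Out-of-sample stability: renormalizing a row [p] after scaling it by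
    [e^v] moves it by at most the size of [v] and its own marginal defect. *)
Lemma row_stability (p pn v : 'I_n -> R) (k M D : R) :
  0 < k -> (forall j, k <= p j <= M) -> (forall j, `|v j| <= D) ->
  (forall j, pn j * avg (fun l => p l * expR (v l)) = p j * expR (v j)) ->
  avg (fun j => (pn j - p j) ^+ 2) <=
  (M * expR D / k) ^+ 2 *
  ((2 + 4 * M ^+ 2) * expR D ^+ 2 * avg (fun j => v j ^+ 2) +
   4 * (1 - avg p) ^+ 2).
Proof.
move=> k0 pkM vD pnE.
set S := avg (fun l => p l * expR (v l)); set V := avg (fun j => v j ^+ 2).
set G := 1 - avg p; set E := expR D.
have E0 : 0 < E by exact: expR_gt0.
have kM : k <= M.
  have j : 'I_n by exact: (Ordinal n0).
  by have /andP[] := pkM j; exact: le_trans.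
have M0 : 0 < M by exact: lt_le_trans kM.
have p0 j : 0 < p j by have /andP[+ _] := pkM j; exact: lt_le_trans.
have kES : k / E <= S.
  rewrite -[leLHS]avg_cst; apply: avg_le => j.
  rewrite ler_pM ?invr_ge0 ?(ltW k0) ?(ltW E0)//; first by case/andP: (pkM j).
  rewrite /E -expRN ler_expR.
  by have := vD j; rewrite ler_norml => /andP[].
have S0 : 0 < S by apply: lt_le_trans kES; rewrite divr_gt0.
have B : avg (fun j => (expR (v j) - 1) ^+ 2) <= E ^+ 2 * V.
  by rewrite /V -avgZ; apply: avg_le => j; exact: expR_sub1_sqr_le.
have S1 : (S - 1) ^+ 2 <= 2 * M ^+ 2 * (E ^+ 2 * V) + 2 * G ^+ 2.
  pose A := avg (fun j => p j * (expR (v j) - 1)).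
  have -> : S - 1 = A - G.
    rewrite /A /G /S (_ : avg (fun j => p j * (expR (v j) - 1)) =
      avg (fun j => p j * expR (v j)) - avg p); first by ring.
    by rewrite -avgB; congr (_ * _); apply: eq_bigr => j _; ring.
  have A2 : A ^+ 2 <= M ^+ 2 * (E ^+ 2 * V).
    apply: (le_trans (sqr_avg_le _)); apply: (@le_trans _ _ (M ^+ 2 * avg (fun j => (expR (v j) - 1) ^+ 2))).
      rewrite -avgZ; apply: avg_le => j; rewrite exprMn ler_wpM2r ?sqr_ge0//.
      by rewrite ler_sqr ?nnegrE ?(ltW (p0 _)) ?(ltW M0)//; case/andP: (pkM j).
    by rewrite ler_wpM2l ?sqr_ge0.
  by have := sqr_ge0 (A + G); lra.
have step j : (pn j - p j) ^+ 2 <=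
    (M * E / k) ^+ 2 * (2 * (expR (v j) - 1) ^+ 2 + 2 * (S - 1) ^+ 2).
  have -> : pn j - p j = p j / S * ((expR (v j) - 1) - (S - 1)).
    have pnj : pn j = p j * expR (v j) / S by rewrite -pnE mulfK// gt_eqF.
    by rewrite pnj; field; rewrite gt_eqF.
  rewrite exprMn ler_pM ?sqr_ge0//; last first.
    by have := sqr_ge0 (expR (v j) - 1 + (S - 1)); lra.
  have pS0 : 0 <= p j / S by rewrite divr_ge0 ?ltW.
  rewrite ler_sqr ?nnegrE//; last by rewrite divr_ge0 ?mulr_ge0 ?ltW.
  rewrite -mulrA ler_pM ?invr_ge0 ?(ltW (p0 _)) ?(ltW S0)//; first by case/andP: (pkM j).
  have -> : E / k = (k / E)^-1 by rewrite invf_div.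
  by rewrite lef_pV2 ?posrE// divr_gt0.
apply: (@le_trans _ _ (avg (fun j => (M * E / k) ^+ 2 * (2 * (expR (v j) - 1) ^+ 2 + 2 * (S - 1) ^+ 2)))).
  exact: avg_le.
rewrite avgZ ler_wpM2l ?sqr_ge0// avgD avgZ avg_cst.
by lra.
Qed.

End finite_averages.

Section estimator_stability.
Context (R : realType) (eta : R) (d n : nat).
Hypotheses (eta0 : 0 < eta) (n0 : (0 < n)%N).
Local Notation V := (d.-tuple R).
Local Notation e := (expR (- eta)).
Local Notation avg F := (n%:R^-1 * \sum_(j < n) F j).
Variables (a b : V -> R).
Hypotheses (aE : forall u, 1 <= a u <= e^-1) (bE : forall v, e <= b v <= e^-1).

Let e0 : 0 < e. Proof. exact: expR_gt0. Qed.
Let a0 u : 0 < a u.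
Proof. by have /andP[+ _] := aE u; apply: lt_le_trans. Qed.
Let b0 u : 0 < b u.
Proof. by have /andP[+ _] := bE u; apply: lt_le_trans. Qed.

(** Constant of the stability estimate; it depends on [eta] only. *)
Definition stability_cst : R :=
  (e^-1 ^+ 2 * expR (3 * eta) / e ^+ 2) ^+ 2 *
  ((2 + 4 * (e^-1 ^+ 2) ^+ 2) * expR (3 * eta) ^+ 2 * (e ^+ 2)^-1 ^+ 2 + 4).

Variables (x y : 'I_n -> V) (lab : 'I_n -> R) (f g : V -> R).
Hypotheses (xB : forall i, enorm (x i) <= 2^-1) (yB : forall j, enorm (y j) <= 2^-1).
Hypothesis lab1 : forall j, `|lab j| <= 1.
Hypothesis row : forall u, avg (fun j => gibbs eta f g u (y j)) = 1.
Hypothesis col : forall v, avg (fun i => gibbs eta f g (x i) v) = 1.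

Let A u := expR (eta * f u).
Let B j := expR (eta * g (y j)).

Let gibbsK u j : enorm u <= 2^-1 -> gibbs eta f g u (y j) = tkernel eta (u, y j) * A u * B j.
Proof.
move=> uB; rewrite /gibbs /tkernel tcost_sqdist// /A /B -!expRD.
by congr expR; ring.
Qed.

Let A0 u : 0 < A u. Proof. exact: expR_gt0. Qed.
Let B0 j : 0 < B j. Proof. exact: expR_gt0. Qed.

(* Both columns [j] and [k] have unit mass for the same scalings [A], and the
   kernel lies in [e, 1]. *)
Let B_ratio j k : e * B j <= B k.
Proof.
pose SA := avg (fun i => A (x i)).
have h1 : 1 <= SA * B k.
  rewrite -(col (y k)) /SA -mulrA mulr_suml; apply: avg_le => i.
  rewrite gibbsK// -mulrA ler_piMl ?tkernel_le1//.
  by rewrite mulr_ge0 ?ltW.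
have h2 : e * B j * SA <= 1.
  rewrite -(col (y j)) /SA -avgZ; apply: avg_le => i.
  rewrite gibbsK// mulrAC; apply: ler_wpM2r; first exact/ltW/B0.
  by apply: ler_wpM2r; [exact/ltW/A0|exact: tkernel_ge].
have SA0 : 0 < SA by have := lt_le_trans ltr01 h1; rewrite pmulr_lgt0.
by rewrite -(ler_pM2r SA0) (le_trans h2)// mulrC.
Qed.

Let gibbs_ge u j : enorm u <= 2^-1 -> e ^+ 2 <= gibbs eta f g u (y j).
Proof.
move=> uB; rewrite gibbsK//.
have h1 : 1 <= A u * avg (fun k => B k).
  rewrite -[leLHS](row u) -(avgZ (A u) B); apply: avg_le => k.
  by rewrite gibbsK// -mulrA ler_piMl ?tkernel_le1// mulr_ge0 ?ltW.
have h2 : e * avg (fun k => B k) <= B j.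
  by rewrite -(avgZ e B) -[leRHS](avg_cst n0); apply: avg_le => k; exact: B_ratio.
apply: (@le_trans _ _ (e * A u * (e * avg (fun k => B k)))).
  rewrite expr2 mulrACA -mulrA -[leLHS]mulr1 -mulrA ler_wpM2l ?(ltW e0)//.
  by rewrite ler_wpM2l ?(ltW e0)// h1.
apply: ler_pM => //.
- by apply: mulr_ge0; [exact: ltW|exact/ltW/A0].
- apply: mulr_ge0; first exact: ltW.
  by apply: mulr_ge0; [rewrite invr_ge0|apply: sumr_ge0 => k _; exact/ltW/B0].
- by apply: ler_wpM2r; [exact/ltW/A0|exact: tkernel_ge].
Qed.

(* Log-scalings from [sdensity] to the empirical density; the shift [s] makes
   [v] average to zero and cancels in [u_ i + v j]. *)
Let s := avg (fun j => eta * g (y j) - ln (b (y j))).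
Let v j := eta * g (y j) - ln (b (y j)) - s.
Let u_ i := eta * f (x i) - ln (a (x i)) + s.

Let v0 : avg (fun j => v j) = 0.
Proof. by rewrite /v avgB avg_cst// subrr. Qed.

Let v_le j : `|v j| <= 3 * eta.
Proof.
apply: (avg_zero_norm_le n0 v0) => {}j k.
have h1 : - eta + eta * g (y j) <= eta * g (y k).
  by rewrite -ler_expR expRD; exact: B_ratio.
have lnb l : - eta <= ln (b (y l)) <= eta.
  have /andP[b1 b2] := bE (y l).
  rewrite -[X in X <= _ <= _]expRK ler_ln ?posrE// b1/=.
  have -> : eta = ln (e^-1) by rewrite lnV ?posrE// expRK opprK.
  by rewrite ler_ln ?posrE// invr_gt0.
by have /andP[? ?] := lnb j; have /andP[? ?] := lnb k; rewrite /v; lra.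
Qed.

(** For samples in the ball, the plug-in error of the estimator at [u] is
    controlled by the marginal defects of the population density at [u] and on
    the sample. *)
Lemma estimator_stability u : enorm u <= 2^-1 ->
  (transfer_estimator eta y lab f g u - avg (fun j => lab j * sdensity eta a b (u, y j))) ^+ 2 <=
  stability_cst *
    ((1 - avg (fun j => sdensity eta a b (u, y j))) ^+ 2 +
     (avg (fun i => (1 - avg (fun j => sdensity eta a b (x i, y j))) ^+ 2) +
      avg (fun j => (1 - avg (fun i => sdensity eta a b (x i, y j))) ^+ 2))).
Proof.
move=> uB.
have k0 : 0 < e ^+ 2 by rewrite exprn_gt0.
have expv j : expR (v j) = B j / b (y j) * expR (- s).
  by rewrite /v !expRD expRN lnK ?posrE.
have expu i : expR (u_ i) = A (x i) / a (x i) * expR s.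
  by rewrite /u_ !expRD [expR (- ln _)]expRN lnK ?posrE.
have ss : expR s * expR (- s) = 1 by rewrite -expRD subrr expR0.
have PNE i j : gibbs eta f g (x i) (y j) = sdensity eta a b (x i, y j) * expR (u_ i + v j).
  rewrite expRD expu expv gibbsK// /sdensity/=.
  transitivity (tkernel eta (x i, y j) * A (x i) * B j * (expR s * expR (- s))).
    by rewrite ss mulr1.
  by field; rewrite !gt_eqF.
have W := scaling_stability n0 k0 (fun i j => (andP (sdensity_bounds eta0 aE bE (x i, y j))).1)
  (fun i j => gibbs_ge j (xB i)) PNE (fun i => row (x i)) (fun j => col (y j)) v0.
set W2 := avg (fun i => (1 - _) ^+ 2) + avg (fun j => (1 - _) ^+ 2) in W *.
have U0 : 0 <= avg (fun i => u_ i ^+ 2).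
  by rewrite mulr_ge0 ?invr_ge0// sumr_ge0// => i _; exact: sqr_ge0.
have V2 : avg (fun j => v j ^+ 2) <= (e ^+ 2)^-1 ^+ 2 * W2 by apply: le_trans W; rewrite lerDr.
have W20 : 0 <= W2.
  by rewrite addr_ge0// mulr_ge0 ?invr_ge0// sumr_ge0// => i _; exact: sqr_ge0.
have rowE j : gibbs eta f g u (y j) * avg (fun l => sdensity eta a b (u, y l) * expR (v l)) =
    sdensity eta a b (u, y j) * expR (v j).
  have AvE : A u * avg (fun l => sdensity eta a b (u, y l) * expR (v l)) = a u * expR (- s).
    transitivity (a u * expR (- s) * avg (fun l => gibbs eta f g u (y l))); last by rewrite row mulr1.
    rewrite -!avgZ; congr (_ * _); apply: eq_bigr => l _.
    by rewrite expv gibbsK// /sdensity/=; field; rewrite gt_eqF.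
  rewrite gibbsK//; move: AvE; set S := avg (fun l => _) => AvE.
  have regroup (k r t w : R) : k * r * t * w = k * t * (r * w) by ring.
  rewrite regroup AvE.
  by rewrite expv /sdensity/=; field; rewrite gt_eqF.
have S := row_stability n0 k0 (fun j => sdensity_bounds eta0 aE bE (u, y j)) v_le rowE.
apply: (@le_trans _ _ (avg (fun j => (gibbs eta f g u (y j) - sdensity eta a b (u, y j)) ^+ 2))).
  have -> : transfer_estimator eta y lab f g u - avg (fun j => lab j * sdensity eta a b (u, y j)) =
      avg (fun j => lab j * (gibbs eta f g u (y j) - sdensity eta a b (u, y j))).
    rewrite /transfer_estimator -avgB; congr (_ * _).
    by apply: eq_bigr => j _; rewrite mulrBr.
  apply: (le_trans (sqr_avg_le n0 _)); apply: avg_le => j.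
  rewrite exprMn ler_piMl ?sqr_ge0// -[leLHS]real_normK ?num_real//.
  by rewrite exprn_ile1.
apply: (le_trans S); rewrite /stability_cst -[leRHS]mulrA; apply: ler_wpM2l; first exact: sqr_ge0.
set G := (1 - _) ^+ 2.
have G0 : 0 <= G by exact: sqr_ge0.
set c := (2 + _) * _; have c0 : 0 <= c by rewrite mulr_ge0 ?addr_ge0 ?mulr_ge0 ?sqr_ge0.
have h : c * avg (fun j => v j ^+ 2) <= c * (e ^+ 2)^-1 ^+ 2 * W2.
  by rewrite -mulrA ler_wpM2l.
have h2 : 0 <= c * (e ^+ 2)^-1 ^+ 2 * G.
  by apply: mulr_ge0 => //; apply: mulr_ge0 => //; exact: sqr_ge0.
have h3 : 0 <= 4 * W2 by rewrite mulr_ge0.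
by lra.
Qed.

End estimator_stability.

(** * Measure-theoretic preliminaries to the risk bound *)

(** The integral of a nonnegative function is a lower integral, so that the
    smaller function need not be measurable here. *)
Lemma ge0_ae_le_integral_lower d (T : measurableType d) (R : realType)
    (mu : {measure set T -> \bar R}) (f g : T -> \bar R) :
  (forall x, 0 <= f x)%E -> (forall x, 0 <= g x)%E -> measurable_fun setT g ->
  {ae mu, forall x, (f x <= g x)%E} ->
  (\int[mu]_x f x <= \int[mu]_x g x)%E.
Proof.
move=> f0 g0 mg [N [mN N0 sub]].
pose g' x := if x \in N then +oo%E else g x.
have g'0 x : (0 <= g' x)%E by rewrite /g'; case: ifP.
have mg' : measurable_fun setT g'.
  rewrite /g'; apply: measurable_fun_ifT => //; first last.
  apply: (measurable_fun_bool true) => //.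
  rewrite setTI (_ : _ @^-1` _ = N)//.
  by apply/seteqP; split => x /=; [move/set_mem|move/mem_set].
have -> : (\int[mu]_x g x = \int[mu]_x g' x)%E.
  apply: ae_eq_integral => //; exists N; split => // x /= h.
  apply: contrapT => xN; apply: h => _; rewrite /g' memNset//.
rewrite !ge0_integralTE//; apply: le_ereal_sup => _ [h hf <-]; exists h => // x.
apply: (le_trans (hf x)).
rewrite /g'; case: ifPn => [_|xN]; first exact: leey.
by apply: contrapT => h'; move: xN; rewrite mem_set//; exact: sub.
Qed.

Lemma sqr_Lnorm2 d (T : measurableType d) (R : realType)
    (mu : {measure set T -> \bar R}) (f : T -> R) :
  ('N[mu]_2%:E[EFin \o f] ^+ 2 = \int[mu]_x (f x ^+ 2)%:E)%E.
Proof.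
have sq (u : \bar R) : (0 <= u -> u ^+ 2 = u `^ 2)%E.
  case: u => [r| |]//; first by rewrite lee_fin => r0; rewrite poweR_EFin powR_mulrn.
  by move=> _; rewrite poweRyr ?expe2 ?mulyy// pnatr_eq0.
rewrite sq ?Lnorm_ge0// poweR_Lnorm ?pnatr_eq0//; apply: eq_integral => x _.
transitivity ((`|f x|%:E : \bar R) `^ 2)%E; first by [].
by rewrite poweR_EFin powR_mulrn// real_normK// num_real.
Qed.

Lemma ae_preimage dO (Omega : measurableType dO) d (T : measurableType d) (R : realType)
    (P : {measure set Omega -> \bar R}) (mu : {measure set T -> \bar R})
    (X : Omega -> T) (Q : T -> Prop) : measurable_fun setT X ->
  (forall B, measurable B -> P (X @^-1` B) = mu B) ->
  {ae mu, forall x, Q x} -> {ae P, forall w, Q (X w)}.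
Proof.
move=> mX PX [N [mN N0 sub]]; exists (X @^-1` N); split.
- by rewrite -[X in measurable X]setTI; exact: mX.
- by rewrite PX.
- by move=> w /= h; apply: sub.
Qed.

Lemma bmeas_Lfun2 d (T : measurableType d) (R : realType) (mu : probability T R)
    (f : T -> R) : bmeas f -> f \in Lfun mu 2%:E.
Proof.
move=> bf; have l12 : (1 <= 2%:E :> \bar R)%E by rewrite lee_fin ler1n.
apply: (@Lfun_subset _ _ _ mu 2%:E +oo%E l12 (leey _)).
- exact: fin_num_measure.
- exact: leey.
- exact: bmeas_Lfun_oo.
Qed.

Section mutual_independence.
Context dO (Omega : measurableType dO) (R : realType) (P : probability Omega R).
Context (I : finType) (F : I -> set_system Omega).
Hypothesis indep : mutually_independent P F.

Lemma mutually_independent2 i j A B : i != j -> F i A -> F j B ->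
  P (A `&` B) = (P A * P B)%E.
Proof.
move=> ij FA FB.
pose E k := if k == i then A else B.
have := indep (J := [set i; j]%SET) (E := E).
have Ei : E i = A by rewrite /E eqxx.
have Ej : E j = B by rewrite /E eq_sym (negbTE ij).
rewrite big_setU1 ?inE//= big_set1 Ei Ej => <-.
  congr (P _); apply/seteqP; split => w.
    by move=> [Aw Bw] k /=; rewrite !inE => /orP[]/eqP->; rewrite ?Ei ?Ej.
  move=> h; split; [rewrite -Ei|rewrite -Ej]; apply: h; rewrite /= !inE eqxx ?orbT//.
by move=> k; rewrite !inE => /orP[]/eqP->; rewrite ?Ei ?Ej.
Qed.

Lemma mutually_independent3 i j k A B C : i != j -> i != k -> j != k ->
  F i A -> F j B -> F k C -> P (A `&` B `&` C) = (P (A `&` B) * P C)%E.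
Proof.
move=> ij ik jk FA FB FC; rewrite (mutually_independent2 ij FA FB).
pose E l := if l == i then A else if l == j then B else C.
have := indep (J := (i |: (j |: [set k]))%SET) (E := E).
have Ei : E i = A by rewrite /E eqxx.
have Ej : E j = B by rewrite /E eq_sym (negbTE ij) eqxx.
have Ek : E k = C by rewrite /E eq_sym (negbTE ik) eq_sym (negbTE jk).
rewrite big_setU1 ?inE ?negb_or ?ij//= big_setU1 ?inE//= big_set1.
rewrite Ei Ej Ek muleA => <-.
  congr (P _); apply/seteqP; split => w.
    by move=> [[Aw Bw] Cw] l /=; rewrite !inE => /orP[|/orP[]]/eqP->; rewrite ?Ei ?Ej ?Ek.
  move=> h; split; [split|]; [rewrite -Ei|rewrite -Ej|rewrite -Ek]; apply: h;
    by rewrite /= !inE eqxx ?orbT.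
by move=> l; rewrite !inE => /orP[|/orP[]]/eqP->; rewrite ?Ei ?Ej ?Ek.
Qed.

End mutual_independence.

Lemma sigma_of_preimage dO (Omega : measurableType dO) d (T : measurableType d)
    (X : Omega -> T) (B : set T) : measurable B -> sigma_of X (X @^-1` B).
Proof. by move=> mB; exists B => //; rewrite setTI. Qed.

(** * The risk bound *)

Section transfer_risk.
Context (R : realType) (eta : R) (d n : nat).
Hypotheses (eta0 : 0 < eta) (n0 : (0 < n)%N).
Local Notation V := (d.-tuple R).
Local Notation e := (expR (- eta)).
Local Notation M := (e^-1 ^+ 2).
Local Notation avg F := (n%:R^-1 * \sum_(j < n) F j).
Variables (mu nu : probability V R).
Variables (a b : V -> R).
Hypotheses (ba : bmeas a) (bb : bmeas b).
Hypotheses (aE : forall u, 1 <= a u <= e^-1) (bE : forall v, e <= b v <= e^-1).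
Hypothesis ab1 : forall x, a x * \int[nu]_y (tkernel eta (x, y) * b y) = 1.
Hypothesis ab2 : forall y, b y * \int[mu]_x (tkernel eta (x, y) * a x) = 1.

Local Notation p := (sdensity eta a b).

Let pM z : 0 <= p z <= M.
Proof.
have /andP[p1 p2] := sdensity_bounds eta0 aE bE z.
by rewrite p2 andbT (le_trans _ p1)// exprn_ge0// expR_ge0.
Qed.

Variables (q : R.-pker V ~> R) (m : probability (V * R)%type R).
Hypothesis law : joint_law nu q m.
Context (dO : measure_display) (Omega : measurableType dO) (P : probability Omega R).
Variables (X : 'I_n -> {RV P >-> V}) (L : 'I_n -> {RV P >-> (V * R)%type}).
Hypothesis indep : mutually_independent P (fun k : 'I_n + 'I_n =>
  match k with inl i => sigma_of (X i) | inr j => sigma_of (L j) end).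
Hypothesis Xlaw : forall i B, measurable B -> P (X i @^-1` B) = mu B.
Hypothesis Llaw : forall j B, measurable B -> P (L j @^-1` B) = m B.

Let h0 := regression p m.

Let bp := bmeas_sdensity eta ba bb.

Let bh0 : bmeas h0. Proof. exact: (bmeas_regression mu bp m). Qed.

(* The three centred kernels whose empirical averages control the error. *)
Let phi1 (z : V * (V * R)) := clip1 z.2.2 * p (z.1, z.2.1) - h0 z.1.
Let phi2 (z : V * (V * R)) := 1 - p (z.1, z.2.1).
Let phi3 (z : (V * R) * V) := 1 - p (z.2, z.1.1).

Let bphi1 : bmeas phi1.
Proof.
apply: bmeasB; first exact: (bmeas_regression_kernel bp).
exact: (bmeas_comp measurable_fst bh0).
Qed.

Let bphi2 : bmeas phi2.
Proof.
apply: bmeasB; first exact: bmeas_cst.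
apply: (bmeas_comp _ bp); apply: measurable_fun_pair => //.
exact: (measurableT_comp measurable_fst measurable_snd).
Qed.

Let bphi3 : bmeas phi3.
Proof.
apply: bmeasB; first exact: bmeas_cst.
apply: (bmeas_comp _ bp); apply: measurable_fun_pair => //.
exact: (measurableT_comp measurable_fst measurable_fst).
Qed.

Let clipM x : forall l : V * R, `|clip1 l.2 * p (x, l.1)| <= M.
Proof.
move=> l; have /andP[p0 p1] := pM (x, l.1).
rewrite normrM (ger0_norm p0) -[leRHS]mul1r ler_pM//.
exact: norm_clip1.
Qed.

Let phi1M z : `|phi1 z| <= 2 * M.
Proof.
rewrite mulr_natl mulr2n; apply: (le_trans (ler_normB _ _)).
apply: lerD; first exact: clipM.
apply: normr_Rintegral_le; last exact: clipM.
exact: (bmeas_section1 (bmeas_regression_kernel bp) z.1).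
Qed.

Let phi2M z : `|phi2 z| <= M + 1.
Proof.
have /andP[h1 h2] := pM (z.1, z.2.1).
by rewrite /phi2 ler_norml; apply/andP; split; lra.
Qed.

Let phi3M z : `|phi3 z| <= M + 1.
Proof.
have /andP[h1 h2] := pM (z.2, z.1.1).
by rewrite /phi3 ler_norml; apply/andP; split; lra.
Qed.

Let phi1_0 x : \int[m]_l phi1 (x, l) = 0.
Proof.
rewrite /phi1/= bmeas_RintegralB; [|exact: (bmeas_section1 (bmeas_regression_kernel bp) x)|exact: bmeas_cst].
by rewrite Rintegral_probability_cst subrr.
Qed.

Let phi2_0 x : \int[m]_l phi2 (x, l) = 0.
Proof.
rewrite /phi2/= bmeas_RintegralB; [|exact: bmeas_cst|]; last first.
  exact: (bmeas_comp measurable_fst (bmeas_section1 bp x)).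
rewrite Rintegral_probability_cst (regression_density1 bp (sdensity_row bb ab1) law).
exact: subrr.
Qed.

Let phi3_0 l : \int[mu]_x phi3 (l, x) = 0.
Proof.
rewrite /phi3/= bmeas_RintegralB; [|exact: bmeas_cst|exact: (bmeas_section2 bp)].
by rewrite Rintegral_probability_cst (sdensity_col ba ab2) subrr.
Qed.

(* A fixed point [x], as a constant random variable. *)
Let cst_mfun (x : V) : {mfun Omega >-> V} :=
  HB.pack (cst x) (isMeasurableFun.Build _ _ _ _ (cst x) (measurable_cst x)).

Let indep_cst x j k : j != k -> forall A B C,
  measurable A -> measurable B -> measurable C ->
  P (cst_mfun x @^-1` A `&` L j @^-1` B `&` L k @^-1` C) =
  (P (cst_mfun x @^-1` A `&` L j @^-1` B) * m C)%E.
Proof.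
move=> jk A B C mA mB mC; rewrite -(Llaw k mC).
have jk' : (inr j : 'I_n + 'I_n) != inr k by [].
rewrite preimage_cst; case: ifPn => _; last by rewrite !set0I measure0 mul0e.
rewrite !setTI; apply: (mutually_independent2 indep jk') => //; exact: sigma_of_preimage.
Qed.

Let indep_XLL i j k : j != k -> forall A B C,
  measurable A -> measurable B -> measurable C ->
  P (X i @^-1` A `&` L j @^-1` B `&` L k @^-1` C) =
  (P (X i @^-1` A `&` L j @^-1` B) * m C)%E.
Proof.
move=> jk A B C mA mB mC; rewrite -(Llaw k mC).
have jk' : (inr j : 'I_n + 'I_n) != inr k by [].
by apply: (mutually_independent3 indep (i := inl i) _ _ jk') => //; exact: sigma_of_preimage.
Qed.

Let indep_LXX i j k : j != k -> forall A B C,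
  measurable A -> measurable B -> measurable C ->
  P (L i @^-1` A `&` X j @^-1` B `&` X k @^-1` C) =
  (P (L i @^-1` A `&` X j @^-1` B) * mu C)%E.
Proof.
move=> jk A B C mA mB mC; rewrite -(Xlaw k mC).
have jk' : (inl j : 'I_n + 'I_n) != inl k by [].
by apply: (mutually_independent3 indep (i := inr i) _ _ jk') => //; exact: sigma_of_preimage.
Qed.

Local Notation C := (stability_cst eta).

(* Squared fluctuation at the point, squared defect at the point, and mean
   squared row and column defects on the sample. *)
Let H1 (z : Omega * V) := (avg (fun j => phi1 (z.2, L j z.1))) ^+ 2.
Let H2 (z : Omega * V) := (avg (fun j => phi2 (z.2, L j z.1))) ^+ 2.
Let H3 w := avg (fun i => (avg (fun j => phi2 (X i w, L j w))) ^+ 2).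
Let H4 w := avg (fun j => (avg (fun i => phi3 (L j w, X i w))) ^+ 2).

(** Pointwise bound of the squared error, for a sample [w] and a point. *)
Let F (z : Omega * V) := 2 * H1 z + 2 * C * (H2 z + (H3 z.1 + H4 z.1)).

Let bavg dD (D : measurableType dD) (G : 'I_n -> D -> R) : (forall j, bmeas (G j)) ->
  bmeas (fun z => avg (fun j => G j z)).
Proof. by move=> bG; apply: bmeasM; [exact: bmeas_cst|exact: bmeas_sum]. Qed.

Let bL (phi : V * (V * R) -> R) j : bmeas phi ->
  bmeas (fun z : Omega * V => phi (z.2, L j z.1)).
Proof.
move=> bphi; apply: (bmeas_comp _ bphi); apply: measurable_fun_pair => //.
exact: (measurableT_comp (measurable_funPT (L j)) measurable_fst).
Qed.

Let bH1 : bmeas H1. Proof. by apply/bmeasX/bavg => j; exact: bL. Qed.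
Let bH2 : bmeas H2. Proof. by apply/bmeasX/bavg => j; exact: bL. Qed.

Let bXL (phi : V * (V * R) -> R) i j : bmeas phi -> bmeas (fun w => phi (X i w, L j w)).
Proof. by apply: bmeas_comp; apply: measurable_fun_pair; exact: measurable_funPT. Qed.

Let bLX (phi : (V * R) * V -> R) i j : bmeas phi -> bmeas (fun w => phi (L j w, X i w)).
Proof. by apply: bmeas_comp; apply: measurable_fun_pair; exact: measurable_funPT. Qed.

Let bH3 : bmeas H3.
Proof. by apply: bavg => i; apply/bmeasX/bavg => j; exact: bXL. Qed.

Let bH4 : bmeas H4.
Proof. by apply: bavg => i; apply/bmeasX/bavg => j; exact: bLX. Qed.

Let bF : bmeas F.
Proof.
apply: bmeasD; first by apply: bmeasM => //; exact: bmeas_cst.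
apply: bmeasM; first exact: bmeas_cst.
by apply: bmeasD => //; apply: bmeasD; exact: (bmeas_comp measurable_fst).
Qed.

Lemma stability_cst_ge0 : 0 <= C.
Proof.
have e0 : 0 < e by exact: expR_gt0.
by rewrite /stability_cst mulr_ge0 ?sqr_ge0// addr_ge0// !mulr_ge0 ?sqr_ge0// addr_ge0// mulr_ge0// sqr_ge0.
Qed.

(** Constant of the risk bound; it depends on [eta] only. *)
Definition risk_cst : R := 2 * (2 * M) ^+ 2 + 6 * C * (M + 1) ^+ 2.

Let EH1 x : \int[P]_w H1 (w, x) <= (2 * M) ^+ 2 / n%:R.
Proof. exact: (variance_average (indep_cst x) bphi1 phi1M phi1_0). Qed.

Let EH2 x : \int[P]_w H2 (w, x) <= (M + 1) ^+ 2 / n%:R.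
Proof. exact: (variance_average (indep_cst x) bphi2 phi2M phi2_0). Qed.

Let EH3 : \int[P]_w H3 w <= (M + 1) ^+ 2 / n%:R.
Proof.
rewrite /H3 bmeas_RintegralZl; last first.
  by apply: bmeas_sum => i; apply/bmeasX/bavg => j; exact: bXL.
rewrite bmeas_Rintegral_sum; last by move=> i; apply/bmeasX/bavg => j; exact: bXL.
rewrite -[leRHS](avg_cst n0); apply: avg_le => i.
exact: (variance_average (indep_XLL i) bphi2 phi2M phi2_0).
Qed.

Let EH4 : \int[P]_w H4 w <= (M + 1) ^+ 2 / n%:R.
Proof.
rewrite /H4 bmeas_RintegralZl; last first.
  by apply: bmeas_sum => i; apply/bmeasX/bavg => j; exact: bLX.
rewrite bmeas_Rintegral_sum; last by move=> i; apply/bmeasX/bavg => j; exact: bLX.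
rewrite -[leRHS](avg_cst n0); apply: avg_le => i.
exact: (variance_average (indep_LXX i) bphi3 phi3M phi3_0).
Qed.

Let EF : \int[P]_w \int[mu]_x F (w, x) <= risk_cst / n%:R.
Proof.
rewrite -(bmeas_Rintegral_prod12 P mu bF) (bmeas_Rintegral_prod21 P mu bF).
apply: le_Rintegral_cst; first exact: (bmeas_Rintegral2 P mu bF).
move=> x; rewrite /F/=.
have b1 := bmeas_section2 bH1 x; have b2 := bmeas_section2 bH2 x.
have bc (c : R) (f : Omega -> R) : bmeas f -> bmeas (fun w => c * f w).
  by move=> bf; apply: bmeasM => //; exact: bmeas_cst.
have b34 : bmeas (fun w => H3 w + H4 w) by exact: bmeasD.
rewrite bmeas_RintegralD; [|exact: bc|by apply: bc; exact: bmeasD].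
rewrite !bmeas_RintegralZl//; last exact: bmeasD.
rewrite !bmeas_RintegralD//.
have h1 := EH1 x; have h2 := EH2 x; have h3 := EH3; have h4 := EH4.
have C0 := stability_cst_ge0.
have h : C * (\int[P]_w H2 (w, x) + (\int[P]_w H3 w + \int[P]_w H4 w)) <=
    C * (3 * ((M + 1) ^+ 2 / n%:R)) by rewrite ler_wpM2l//; lra.
rewrite /risk_cst -!mulrA; move: h1 h; rewrite mulrDl -!mulrA.
by lra.
Qed.

Variables (f_n g_n : Omega -> V -> R).
Hypothesis potentials : forall w, empirical_potentials eta
  (fun i => X i w) (fun j => (L j w).1) (f_n w) (g_n w).

Let h_n w := transfer_estimator eta
  (fun j => (L j w).1) (fun j => (L j w).2) (f_n w) (g_n w).

Lemma error_pointwise w x : (forall i, enorm (X i w) <= 2^-1) ->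
  (forall j, enorm (L j w).1 <= 2^-1) -> (forall j, `|(L j w).2| <= 1) ->
  enorm x <= 2^-1 -> (h0 x - h_n w x) ^+ 2 <= F (w, x).
Proof.
move=> XB YB AB xB.
have [row col] := empirical_potentials_marginals eta0 n0 (potentials w).
have S := estimator_stability eta0 n0 aE bE XB YB AB row col xB.
have E1 : avg (fun j => (L j w).2 * p (x, (L j w).1)) - h0 x = avg (fun j => phi1 (x, L j w)).
  rewrite -[X in _ - X](avg_cst n0) -avgB; congr (_ * _); apply: eq_bigr => j _.
  by rewrite /phi1/= clip1_id.
have E2 u : 1 - avg (fun j => p (u, (L j w).1)) = avg (fun j => phi2 (u, L j w)).
  by rewrite -[X in X - _](avg_cst n0) -avgB.
have E3 l : 1 - avg (fun i => p (X i w, l.1)) = avg (fun i => phi3 (l, X i w)).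
  by rewrite -[X in X - _](avg_cst n0) -avgB.
have S' : (h_n w x - avg (fun j => (L j w).2 * p (x, (L j w).1))) ^+ 2 <=
    C * (H2 (w, x) + (H3 w + H4 w)).
  apply: (le_trans S); rewrite le_eqVlt; apply/orP; left; apply/eqP.
  congr (_ * (_ + (_ + _))).
  - by rewrite /H2/= -E2.
  - by congr (_ * _); apply: eq_bigr => i _; rewrite -E2.
  - by congr (_ * _); apply: eq_bigr => j _; rewrite -E3.
rewrite /F /H1/= -E1.
move: S'; set G := avg (fun j => (L j w).2 * p (x, (L j w).1)).
set T := C * _ => S'.
have := sqr_ge0 ((h0 x - G) - (G - h_n w x)).
by rewrite -[2 * C * _]mulrA -/T; nra.
Qed.

(** The risk bound for the regression function, for samples almost surely in
    the ball with labels in [-1, 1]. *)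
Lemma regression_risk (h : V -> R) : {ae mu, forall x, h x = h0 x} ->
  {ae mu, forall x, enorm x <= 2^-1} ->
  {ae P, forall w, [/\ forall i, enorm (X i w) <= 2^-1,
    forall j, enorm (L j w).1 <= 2^-1 & forall j, `|(L j w).2| <= 1]} ->
  (\int[P]_w ('N[mu]_2%:E[EFin \o (h \- h_n w)%R] ^+ 2) <= (risk_cst / n%:R)%:E)%E.
Proof.
move=> hh0 muB good.
have bD : bmeas (fun w => \int[mu]_x F (w, x)) by exact: (bmeas_Rintegral1 P mu bF).
have F0 z : 0 <= F z.
  have a2 (G : 'I_n -> R) : (forall j, 0 <= G j) -> 0 <= avg G.
    by move=> G0; rewrite mulr_ge0 ?invr_ge0// sumr_ge0.
  have H30 : 0 <= H3 z.1 by apply: a2 => i; exact: sqr_ge0.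
  have H40 : 0 <= H4 z.1 by apply: a2 => i; exact: sqr_ge0.
  have H10 : 0 <= H1 z by exact: sqr_ge0.
  have H20 : 0 <= H2 z by exact: sqr_ge0.
  have C0 := stability_cst_ge0.
  rewrite /F; apply: addr_ge0; first exact: mulr_ge0.
  by apply: mulr_ge0; [exact: mulr_ge0|rewrite !addr_ge0].
apply: (@le_trans _ _ (\int[P]_w (\int[mu]_x F (w, x))%:E)%E); last first.
  by rewrite bmeas_RintegralE// lee_fin EF.
apply: ge0_ae_le_integral_lower => //.
- by move=> w; rewrite expe2 mule_ge0// Lnorm_ge0.
- by move=> w; rewrite lee_fin; apply: Rintegral_ge0.
- by apply/measurable_EFinP; case: bD.
apply: filterS good => w [XB YB AB].
have bFw : bmeas (fun x => F (w, x)) by exact: bmeas_section1.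
rewrite sqr_Lnorm2 -bmeas_RintegralE//.
apply: ge0_ae_le_integral_lower => //.
- by move=> x; rewrite lee_fin sqr_ge0.
- by move=> x; rewrite lee_fin.
- by apply/measurable_EFinP; case: bFw.
apply: filterS2 hh0 muB => x hx xB.
by rewrite lee_fin /= hx; exact: error_pointwise.
Qed.

End transfer_risk.

Section transfer_laws.
Context (R : realType) (dV : measure_display) (V : measurableType dV).
Variables (nu : probability V R) (q : R.-pker V ~> R) (m : probability (V * R)%type R).
Hypothesis law : joint_law nu q m.

Lemma joint_law_fst B : measurable B -> m (fst @^-1` B) = nu B.
Proof.
move=> mB; transitivity (m (B `*` setT)).
  by congr (m _); apply/seteqP; split => z //= -[].
rewrite law//; under eq_integral do rewrite prob_kernel.
by rewrite integral_cst// mul1e.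
Qed.

(** The label has the same law in the coupled model and in the sample. *)
Lemma joint_law_snd dW (W : measurableType dW) (mu : probability W R)
    (pi : probability (W * V)%type R) (omega : probability ((W * V) * R)%type R) C :
  coupling mu nu pi -> joint_law pi (fun z => q z.2) omega -> measurable C ->
  m (snd @^-1` C) = omega (snd @^-1` C).
Proof.
move=> cpi omega_law mC.
transitivity (m (setT `*` C)).
  by congr (m _); apply/seteqP; split => z //= -[].
transitivity (omega (setT `*` C)); last first.
  by congr (omega _); apply/seteqP; split => z //= -[].
have bk := bmeas_kernel q mC.
rewrite law// omega_law//.
transitivity (\int[nu]_y (fine (q y C)))%:E.
  rewrite -bmeas_RintegralE//; apply: eq_integral => y _.
  by rewrite pkernel_fineK.
rewrite -(coupling_snd_Rintegral cpi bk) -bmeas_RintegralE; last first.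
  exact: (bmeas_comp measurable_snd bk).
by apply: eq_integral => z _; rewrite pkernel_fineK.
Qed.

End transfer_laws.

Theorem theorem6 (R : realType) (eta : R) (eta_gt0 : 0 < eta) :
  exists c : R, forall (d n : nat) (d_ge1 : (1 <= d)%N) (n_ge1 : (1 <= n)%N)
    (mu nu : probability (d.-tuple R) R)
    (mu_bounded : {ae mu, forall x, enorm x <= 2^-1})
    (nu_bounded : {ae nu, forall y, enorm y <= 2^-1})
    (pi_star : probability (d.-tuple R * d.-tuple R)%type R)
    (pi_star_opt : schrodinger_coupling eta mu nu pi_star)
    (q : R.-pker (d.-tuple R) ~> R)
    (omega : probability ((d.-tuple R * d.-tuple R) * R)%type R)
    (omega_law : joint_law pi_star (fun z => q z.2) omega)
    (A_bounded : {ae omega, forall z, `|z.2| <= 1})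
    (h_star : d.-tuple R -> R)
    (h_star_opt : risk_minimizer mu omega h_star)
    (dO : measure_display) (Omega : measurableType dO)
    (P : probability Omega R)
    (X : 'I_n -> {RV P >-> d.-tuple R})
    (L : 'I_n -> {RV P >-> (d.-tuple R * R)%type})
    (sample : transfer_sample mu nu q X L)
    (f_n g_n : Omega -> d.-tuple R -> R)
    (potentials : forall w, empirical_potentials eta
       (fun i => X i w) (fun j => (L j w).1) (f_n w) (g_n w)),
  let h_n := fun w => transfer_estimator eta
    (fun j => (L j w).1) (fun j => (L j w).2) (f_n w) (g_n w) in
  (\int[P]_w ('N[mu]_2%:E[EFin \o (h_star \- h_n w)%R] ^+ 2)
     <= (c / n%:R)%:E)%E.
Proof.
exists (risk_cst eta) => d n _ n0 mu nu muB nuB pi piopt q omega wlaw AB h [hL hmin].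
move=> dO Omega P X L [indep Xlaw Llaw] f_n g_n pot /=.
have [a [b [ba bb aE bE [ab1 ab2]]]] :=
  schrodinger_system mu nu (bmeas_tkernel eta d) (expR_gt0 (- eta))
    (tkernel_ge eta_gt0) (tkernel_le1 eta_gt0).
have piE := schrodinger_coupling_density eta_gt0 muB nuB ba bb aE bE ab1 ab2 piopt.
have [cpi _] := piopt.
pose m : probability _ R := distribution P (L (Ordinal n0)).
have law : joint_law nu q m by exact: Llaw.
(* The labelled observations share one law: they agree on rectangles. *)
have Lm j B : measurable B -> P (L j @^-1` B) = m B.
  move=> mB; apply: (measure_eq_on_boxes (m := distribution P (L j)) (m' := m)) => //.
    apply: (@le_lt_trans _ _ 1%E); last exact: ltry.
    exact: (@probability_le1 _ _ _ (distribution P (L j))).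
  by move=> A C mA mC; rewrite (Llaw j)// law.
have bp := bmeas_sdensity eta ba bb.
have p0 z : 0 <= sdensity eta a b z by exact/ltW/(sdensity_gt0 aE bE).
have mh : measurable_fun setT h.
  by move: hL; rewrite inE => /andP[]; rewrite inE.
have hh0 : {ae mu, forall x, h x = regression (sdensity eta a b) m x}.
  apply: (risk_minimizer_regression bp p0 (sdensity_row bb ab1) piE law wlaw AB mh).
    move=> g bg; apply: (hmin (fun x => h x + g x)).
    have l12 : (1 <= 2%:E :> \bar R)%E by rewrite lee_fin ler1n.
    have [_ LD] := Lfun_addr_closed mu l12.
    by apply: LD => //; exact: bmeas_Lfun2.
  (* The zero predictor has risk at most 1, so the minimal risk is finite. *)
  apply: (le_lt_trans (hmin _ (bmeas_Lfun2 mu (bmeas_cst _ 0)))).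
  apply: (@le_lt_trans _ _ (\int[omega]_z (1 : R)%:E)%E); last first.
    by rewrite integral_cst// mul1e; apply: (@le_lt_trans _ _ 1%E); [exact: probability_le1|exact: ltry].
  apply: ge0_ae_le_integral_lower => //.
  apply: filterS AB => z hz; rewrite lee_fin sub0r normrN.
  by rewrite exprn_ile1.
apply: (regression_risk eta_gt0 n0 ba bb aE bE ab1 ab2 law indep _ Lm pot hh0 muB).
  by move=> i B mB; exact: Xlaw.
have XB : {ae P, forall w, forall i, enorm (X i w) <= 2^-1}.
  apply: filter_forall => i.
  apply: (ae_preimage (mu := mu) _ _ muB) => // B mB.
  exact: Xlaw.
have YB : {ae P, forall w, forall j, enorm (L j w).1 <= 2^-1}.
  apply: filter_forall => j.
  apply: (ae_preimage (X := fst \o L j) (mu := nu) _ _ nuB).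
    exact: (measurableT_comp measurable_fst (measurable_funPT (L j))).
  move=> B mB; apply: etrans (joint_law_fst law mB); apply: Lm.
  by rewrite -[X in measurable X]setTI; exact: measurable_fst.
have LB : {ae P, forall w, forall j, `|(L j w).2| <= 1}.
  apply: filter_forall => j.
  pose C := [set r : R | `|r| <= 1].
  have mC : measurable C.
    have := @measurable_fun_ler _ _ _ setT (fun r : R => `|r|) (cst 1) (@normr_measurable R setT) (measurable_cst _).
    move=> /(_ measurableT [set true]); rewrite setTI => hm.
    rewrite (_ : C = (fun x => `|x| <= 1) @^-1` [set true]); first exact: hm.
    by apply/seteqP; split => x /=.
  have mC2 : measurable (snd @^-1` (~` C) : set (d.-tuple R * R)).
    by rewrite -[X in measurable X]setTI; apply: measurable_snd => //; exact: measurableC.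
  exists ((L j) @^-1` (snd @^-1` (~` C))); split.
  - exact: measurable_preimage.
  - rewrite Lm// (joint_law_snd law cpi wlaw (measurableC mC)).
    case: AB => N [mN N0 sub]; apply/eqP; rewrite eq_le measure_ge0 andbT -N0.
    apply: le_measure; rewrite ?inE//.
    by rewrite -[X in measurable X]setTI; apply: measurable_snd => //; exact: measurableC.
  - by move=> w.
by near=> w; split; near: w.
Unshelve. all: by end_near. Qed.
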